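(* The concurrent linked-list map implementation described in the context (operations insert, remove, contains and rangeQuery, with auxiliary methods find and trim, ignoring memory reclamation and any external index) is lock-free: in every execution, if threads take sufficiently many steps, at least one thread completes its operation (there is no infinite execution suffix in which threads keep taking steps but no operation completes).
   Context: Model: asynchronous shared memory with threads communicating via atomic read, write, and compare-and-swap (CAS(addr, expected, new) atomically replaces the content of addr by new iff it equals expected, and returns whether it did). A shared integer clock globalTS, initially 2, is read atomically by getTS() and atomically fetched-and-incremented by fetchAddTS() (which returns the old value). A special constant $\bot = 1$ denotes an uninitialized timestamp. Pointers carry two low-order bits: a mark bit and a flag bit; a pointer is never both marked and flagged; getRef(p) strips the bits. mark(node) reads $p$ = node.next, returns false if $p$ is marked or flagged, else returns CAS(\&node.next, $p$, $p$ with mark bit set); flag(node) is the same with the flag bit. Node fields: ts (timestamp), key, value (immutable), next (pointer), prior (pointer, written once at initialization). alloc(k,v,$\bot$) creates a node with ts $=\bot$. Initialization: head = node with key $-\infty$, ts 2, prior NULL; tail = node with key $+\infty$, ts 2, next NULL, prior NULL; head.next = tail. find(key): retry: pred := head; predNext := pred.next; curr := getRef(predNext). Loop: while curr.next is marked or flagged { if getRef(curr.next) is NULL break; curr := getRef(curr.next) }; if curr.key $\ge$ key break; pred := curr; predNext := pred.next; if predNext is marked or flagged goto retry; curr := getRef(predNext). After the loop: CAS(\&pred.ts, $\bot$, getTS()). If predNext $\ne$ curr: if not trim(pred, getRef(predNext)) goto retry; predNext := pred.next; if predNext marked or flagged goto retry; curr := predNext; if curr.next is marked or flagged or curr.key <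 key goto retry. Then CAS(\&curr.ts, $\bot$, getTS()); return (pred, curr). trim(pred, victim): curr := victim; while curr.next is marked: curr := getRef(curr.next). CAS(\&curr.ts, $\bot$, getTS()). If flag(curr) fails and curr.next is not flagged, return false. succ := getRef(curr.next); if succ $\ne$ NULL then CAS(\&succ.ts, $\bot$, getTS()). newCurr := alloc(curr.key, curr.value, $\bot$); newCurr.next := succ; newCurr.prior := victim. If CAS(\&pred.next, victim, newCurr) succeeds: CAS(\&newCurr.ts, $\bot$, getTS()); return true. Otherwise return false. insert(key, val): repeat: (pred, curr) := find(key); if curr.key = key return curr.value; newNode := alloc(key, val, $\bot$); newNode.next := curr; newNode.prior := curr; if CAS(\&pred.next, curr, newNode) succeeds: CAS(\&newNode.ts, $\bot$, getTS()); return NO\_VAL. remove(key): repeat: (pred, curr) := find(key); if curr.key $\ne$ key return NO\_VAL; if not mark(curr) continue; find(key); return curr.value. contains(key): (pred, curr) := find(key); if curr.key $\ne$ key return NO\_VAL else return curr.value. rangeQuery(low, high, arr): ts := fetchAddTS(); currKey := low. Loop: (pred, curr) := find(currKey); currKey := pred.key; while pred.ts > ts: pred := pred.prior; if pred.key $\le$ low { curr := pred; break }; ts := getTS() $-1$. Then while curr.key < low: succ := getRef(curr.next); CAS(\&succ.ts, $\bot$, getTS()); while succ.ts > ts: succ := succ.prior; curr := succ. Then count := 0; while curr.key $\le$ high: arr[count] := (curr.key, curr.value); count := count+1; succ := getRef(curr.next); CAS(\&succ.ts, $\bot$, getTS()); while succ.ts > ts: succ := succ.prior; curr := succ. Return count.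 *)

(* Defs.v *)
From Stdlib Require Import ZArith Bool List Arith.
Import ListNotations.

Inductive ekey := KNegInf | KFin (z : Z) | KPosInf.

Definition ekey_lt (a b : ekey) : bool :=
  match a, b with
  | KNegInf, KNegInf => false
  | KNegInf, _ => true
  | KFin _, KNegInf => false
  | KFin x, KFin y => Z.ltb x y
  | KFin _, KPosInf => true
  | KPosInf, _ => false
  end.
Definition ekey_le (a b : ekey) : bool := negb (ekey_lt b a).
Definition ekey_eqb (a b : ekey) : bool := ekey_le a b && ekey_le b a.

Record ptr := mkPtr { pref : nat; pmark : bool; pflag : bool }.
Definition NULL : nat := 0.
Definition plain (a : nat) : ptr := mkPtr a false false.
Definition ptr_eqb (p q : ptr) : bool :=
  Nat.eqb (pref p) (pref q) && Bool.eqb (pmark p) (pmark q)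
  && Bool.eqb (pflag p) (pflag q).
Definition marked_or_flagged (p : ptr) : bool := pmark p || pflag p.

Record node := mkNode
  { ts : nat; key : ekey; value : Z; next : ptr; prior : nat }.
Definition BOT : nat := 1.   (* uninitialized timestamp *)

Record mem := mkMem { heap : nat -> node; globalTS : nat; nextFree : nat }.

Definition HEAD : nat := 1.
Definition TAIL : nat := 2.
Definition default_node : node := mkNode 0 KPosInf 0%Z (plain NULL) NULL.

Definition init_mem : mem :=
  mkMem (fun a => if Nat.eqb a HEAD then mkNode 2 KNegInf 0%Z (plain TAIL) NULL
                  else if Nat.eqb a TAIL then mkNode 2 KPosInf 0%Z (plain NULL) NULL
                  else default_node)
        2 3.

Definition rd (m : mem) (a : nat) : node := heap m a.
Definition set_node (m : mem) (a : nat) (n : node) : mem :=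
  mkMem (fun x => if Nat.eqb x a then n else heap m x) (globalTS m) (nextFree m).
Definition with_ts (n : node) (t : nat) : node :=
  mkNode t (key n) (value n) (next n) (prior n).
Definition with_next (n : node) (p : ptr) : node :=
  mkNode (ts n) (key n) (value n) p (prior n).
Definition cas_ts (m : mem) (a t : nat) : mem * bool :=
  let n := heap m a in
  if Nat.eqb (ts n) BOT then (set_node m a (with_ts n t), true) else (m, false).
Definition cas_next (m : mem) (a : nat) (e p : ptr) : mem * bool :=
  let n := heap m a in
  if ptr_eqb (next n) e then (set_node m a (with_next n p), true) else (m, false).
Definition alloc (m : mem) (n : node) : mem * nat :=
  (mkMem (fun x => if Nat.eqb x (nextFree m) then n else heap m x)
         (globalTS m) (S (nextFree m)), nextFree m).
Definition fetch_add_ts (m : mem) : mem * nat :=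
  (mkMem (heap m) (S (globalTS m)) (nextFree m), globalTS m).

Inductive op :=
| OInsert (k v : Z) | ORemove (k : Z) | OContains (k : Z) | ORange (low high : Z).

(* RVal None = NO_VAL ; RRange count arr *)
Inductive resp := RVal (o : option Z) | RRange (count : nat) (arr : list (ekey * Z)).

Inductive fcont :=
| KIns (k v : Z)
| KRem1 (k : Z)
| KRem2 (curr : nat)
| KCont (k : Z)
| KRQ (low high : Z) (t : nat).

(* Program counters (with the live local variables).  Each step of a thread
   performs at most one access to a mutable shared location (reads of the
   immutable fields key/value/prior are treated as local). *)
Inductive pc :=
| F_Retry (fk : ekey) (fc : fcont)
| F_While (fk : ekey) (fc : fcont) (pred : nat) (predNext : ptr) (curr : nat)
| F_NullTest (fk : ekey) (fc : fcont) (pred : nat) (predNext : ptr) (curr : nat)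
| F_Step (fk : ekey) (fc : fcont) (pred : nat) (predNext : ptr) (curr : nat)
| F_KeyTest (fk : ekey) (fc : fcont) (pred : nat) (predNext : ptr) (curr : nat)
| F_Adv (fk : ekey) (fc : fcont) (pred : nat)
| F_PredTs1 (fk : ekey) (fc : fcont) (pred : nat) (predNext : ptr) (curr : nat)
| F_PredTs2 (fk : ekey) (fc : fcont) (pred : nat) (predNext : ptr) (curr : nat) (t : nat)
| F_AfterTrim (fk : ekey) (fc : fcont) (pred : nat)
| F_Check (fk : ekey) (fc : fcont) (pred curr : nat)
| F_CurrTs1 (fk : ekey) (fc : fcont) (pred curr : nat)
| F_CurrTs2 (fk : ekey) (fc : fcont) (pred curr : nat) (t : nat)
| T_While (fk : ekey) (fc : fcont) (pred victim curr : nat)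
| T_Step (fk : ekey) (fc : fcont) (pred victim curr : nat)
| T_Ts1 (fk : ekey) (fc : fcont) (pred victim curr : nat)
| T_Ts2 (fk : ekey) (fc : fcont) (pred victim curr : nat) (t : nat)
| T_Flag1 (fk : ekey) (fc : fcont) (pred victim curr : nat)
| T_Flag2 (fk : ekey) (fc : fcont) (pred victim curr : nat) (p : ptr)
| T_FlagFail (fk : ekey) (fc : fcont) (pred victim curr : nat)
| T_Succ (fk : ekey) (fc : fcont) (pred victim curr : nat)
| T_SuccTs1 (fk : ekey) (fc : fcont) (pred victim curr succ : nat)
| T_SuccTs2 (fk : ekey) (fc : fcont) (pred victim curr succ : nat) (t : nat)
| T_Alloc (fk : ekey) (fc : fcont) (pred victim curr succ : nat)
| T_Cas (fk : ekey) (fc : fcont) (pred victim newCurr : nat)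
| T_NewTs1 (fk : ekey) (fc : fcont) (pred newCurr : nat)
| T_NewTs2 (fk : ekey) (fc : fcont) (pred newCurr : nat) (t : nat)
| I_Alloc (k v : Z) (pred curr : nat)
| I_Cas (k v : Z) (pred curr newNode : nat)
| I_Ts1 (newNode : nat)
| I_Ts2 (newNode : nat) (t : nat)
| R_Mark1 (k : Z) (curr : nat)
| R_Mark2 (k : Z) (curr : nat) (p : ptr)
| Q_Start (low high : Z)
| Q_Back (low high : Z) (t : nat) (currKey : ekey) (pred curr : nat)
| Q_Refresh (low high : Z) (currKey : ekey)
| Q_Low (low high : Z) (t : nat) (curr : nat)
| Q_LNext (low high : Z) (t : nat) (curr : nat)
| Q_LTs1 (low high : Z) (t : nat) (succ : nat)
| Q_LTs2 (low high : Z) (t : nat) (succ : nat) (g : nat)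
| Q_LBack (low high : Z) (t : nat) (succ : nat)
| Q_Col (low high : Z) (t : nat) (curr : nat) (acc : list (ekey * Z))
| Q_CNext (low high : Z) (t : nat) (curr : nat) (acc : list (ekey * Z))
| Q_CTs1 (low high : Z) (t : nat) (succ : nat) (acc : list (ekey * Z))
| Q_CTs2 (low high : Z) (t : nat) (succ : nat) (g : nat) (acc : list (ekey * Z))
| Q_CBack (low high : Z) (t : nat) (succ : nat) (acc : list (ekey * Z)).

Definition find_ret (m : mem) (fc : fcont) (pred curr : nat) : pc + resp :=
  let c := rd m curr in
  match fc with
  | KIns k v => if ekey_eqb (key c) (KFin k) then inr (RVal (Some (value c)))
                else inl (I_Alloc k v pred curr)
  | KRem1 k => if ekey_eqb (key c) (KFin k) then inl (R_Mark1 k curr)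
               else inr (RVal None)
  | KRem2 c0 => inr (RVal (Some (value (rd m c0))))
  | KCont k => if ekey_eqb (key c) (KFin k) then inr (RVal (Some (value c)))
               else inr (RVal None)
  | KRQ low high t => inl (Q_Back low high t (key (rd m pred)) pred curr)
  end.

Definition exec (m : mem) (s : pc) : mem * (pc + resp) :=
  match s with
  | F_Retry fk fc =>
      let pn := next (rd m HEAD) in (m, inl (F_While fk fc HEAD pn (pref pn)))
  | F_While fk fc pred pn curr =>
      let p := next (rd m curr) in
      (m, inl (if marked_or_flagged p then F_NullTest fk fc pred pn curr
               else F_KeyTest fk fc pred pn curr))
  | F_NullTest fk fc pred pn curr =>
      let p := next (rd m curr) in
      (m, inl (if Nat.eqb (pref p) NULL then F_KeyTest fk fc pred pn curr
               else F_Step fk fc pred pn curr))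
  | F_Step fk fc pred pn curr =>
      let p := next (rd m curr) in (m, inl (F_While fk fc pred pn (pref p)))
  | F_KeyTest fk fc pred pn curr =>
      (m, inl (if ekey_le fk (key (rd m curr)) then F_PredTs1 fk fc pred pn curr
               else F_Adv fk fc curr))
  | F_Adv fk fc pred =>
      let pn := next (rd m pred) in
      (m, inl (if marked_or_flagged pn then F_Retry fk fc
               else F_While fk fc pred pn (pref pn)))
  | F_PredTs1 fk fc pred pn curr => (m, inl (F_PredTs2 fk fc pred pn curr (globalTS m)))
  | F_PredTs2 fk fc pred pn curr t =>
      let (m', _) := cas_ts m pred t in
      (m', inl (if ptr_eqb pn (plain curr) then F_CurrTs1 fk fc pred curr
                else T_While fk fc pred (pref pn) (pref pn)))
  | F_AfterTrim fk fc pred =>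
      let pn := next (rd m pred) in
      (m, inl (if marked_or_flagged pn then F_Retry fk fc
               else F_Check fk fc pred (pref pn)))
  | F_Check fk fc pred curr =>
      let c := rd m curr in
      (m, inl (if marked_or_flagged (next c) || ekey_lt (key c) fk then F_Retry fk fc
               else F_CurrTs1 fk fc pred curr))
  | F_CurrTs1 fk fc pred curr => (m, inl (F_CurrTs2 fk fc pred curr (globalTS m)))
  | F_CurrTs2 fk fc pred curr t =>
      let (m', _) := cas_ts m curr t in (m', find_ret m' fc pred curr)
  | T_While fk fc pred victim curr =>
      let p := next (rd m curr) in
      (m, inl (if pmark p then T_Step fk fc pred victim curr
               else T_Ts1 fk fc pred victim curr))
  | T_Step fk fc pred victim curr =>
      let p := next (rd m curr) in (m, inl (T_While fk fc pred victim (pref p)))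
  | T_Ts1 fk fc pred victim curr =>
      (m, inl (T_Ts2 fk fc pred victim curr (globalTS m)))
  | T_Ts2 fk fc pred victim curr t =>
      let (m', _) := cas_ts m curr t in (m', inl (T_Flag1 fk fc pred victim curr))
  | T_Flag1 fk fc pred victim curr =>
      let p := next (rd m curr) in
      (m, inl (if marked_or_flagged p then T_FlagFail fk fc pred victim curr
               else T_Flag2 fk fc pred victim curr p))
  | T_Flag2 fk fc pred victim curr p =>
      let (m', ok) := cas_next m curr p (mkPtr (pref p) (pmark p) true) in
      (m', inl (if ok then T_Succ fk fc pred victim curr
                else T_FlagFail fk fc pred victim curr))
  | T_FlagFail fk fc pred victim curr =>
      let p := next (rd m curr) in
      (m, inl (if pflag p then T_Succ fk fc pred victim curr
               else F_Retry fk fc (* trim returns false *)))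
  | T_Succ fk fc pred victim curr =>
      let sc := pref (next (rd m curr)) in
      (m, inl (if Nat.eqb sc NULL then T_Alloc fk fc pred victim curr sc
               else T_SuccTs1 fk fc pred victim curr sc))
  | T_SuccTs1 fk fc pred victim curr sc =>
      (m, inl (T_SuccTs2 fk fc pred victim curr sc (globalTS m)))
  | T_SuccTs2 fk fc pred victim curr sc t =>
      let (m', _) := cas_ts m sc t in (m', inl (T_Alloc fk fc pred victim curr sc))
  | T_Alloc fk fc pred victim curr sc =>
      let c := rd m curr in
      let (m', nc) := alloc m (mkNode BOT (key c) (value c) (plain sc) victim) in
      (m', inl (T_Cas fk fc pred victim nc))
  | T_Cas fk fc pred victim nc =>
      let (m', ok) := cas_next m pred (plain victim) (plain nc) in
      (m', inl (if ok then T_NewTs1 fk fc pred nc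
                else F_Retry fk fc (* trim returns false *)))
  | T_NewTs1 fk fc pred nc => (m, inl (T_NewTs2 fk fc pred nc (globalTS m)))
  | T_NewTs2 fk fc pred nc t =>
      let (m', _) := cas_ts m nc t in
      (m', inl (F_AfterTrim fk fc pred (* trim returns true *)))
  | I_Alloc k v pred curr =>
      let (m', n) := alloc m (mkNode BOT (KFin k) v (plain curr) curr) in
      (m', inl (I_Cas k v pred curr n))
  | I_Cas k v pred curr n =>
      let (m', ok) := cas_next m pred (plain curr) (plain n) in
      (m', inl (if ok then I_Ts1 n else F_Retry (KFin k) (KIns k v)))
  | I_Ts1 n => (m, inl (I_Ts2 n (globalTS m)))
  | I_Ts2 n t => let (m', _) := cas_ts m n t in (m', inr (RVal None))
  | R_Mark1 k curr =>
      let p := next (rd m curr) in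
      (m, inl (if marked_or_flagged p then F_Retry (KFin k) (KRem1 k)
               else R_Mark2 k curr p))
  | R_Mark2 k curr p =>
      let (m', ok) := cas_next m curr p (mkPtr (pref p) true (pflag p)) in
      (m', inl (if ok then F_Retry (KFin k) (KRem2 curr)
                else F_Retry (KFin k) (KRem1 k)))
  | Q_Start low high =>
      let (m', t) := fetch_add_ts m in (m', inl (F_Retry (KFin low) (KRQ low high t)))
  | Q_Back low high t ck pred curr =>
      let n := rd m pred in
      (m, inl (if Nat.ltb t (ts n) then Q_Back low high t ck (prior n) curr
               else if ekey_le (key n) (KFin low) then Q_Low low high t pred
               else Q_Refresh low high ck))
  | Q_Refresh low high ck =>
      (m, inl (F_Retry ck (KRQ low high (globalTS m - 1))))
  | Q_Low low high t curr =>
      (m, inl (if ekey_lt (key (rd m curr)) (KFin low) then Q_LNext low high t curr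
               else Q_Col low high t curr []))
  | Q_LNext low high t curr =>
      (m, inl (Q_LTs1 low high t (pref (next (rd m curr)))))
  | Q_LTs1 low high t sc => (m, inl (Q_LTs2 low high t sc (globalTS m)))
  | Q_LTs2 low high t sc g =>
      let (m', _) := cas_ts m sc g in (m', inl (Q_LBack low high t sc))
  | Q_LBack low high t sc =>
      let n := rd m sc in
      (m, inl (if Nat.ltb t (ts n) then Q_LBack low high t (prior n)
               else Q_Low low high t sc))
  | Q_Col low high t curr acc =>
      let n := rd m curr in
      if ekey_le (key n) (KFin high)
      then (m, inl (Q_CNext low high t curr (acc ++ [(key n, value n)])))
      else (m, inr (RRange (length acc) acc))
  | Q_CNext low high t curr acc =>
      (m, inl (Q_CTs1 low high t (pref (next (rd m curr))) acc))
  | Q_CTs1 low high t sc acc => (m, inl (Q_CTs2 low high t sc (globalTS m) acc))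
  | Q_CTs2 low high t sc g acc =>
      let (m', _) := cas_ts m sc g in (m', inl (Q_CBack low high t sc acc))
  | Q_CBack low high t sc acc =>
      let n := rd m sc in
      (m, inl (if Nat.ltb t (ts n) then Q_CBack low high t (prior n) acc
               else Q_Col low high t sc acc))
  end.

Definition start (o : op) : pc :=
  match o with
  | OInsert k v => F_Retry (KFin k) (KIns k v)
  | ORemove k => F_Retry (KFin k) (KRem1 k)
  | OContains k => F_Retry (KFin k) (KCont k)
  | ORange low high => Q_Start low high
  end.

Inductive tstate := Idle | Busy (s : pc).

Inductive tstep : mem -> tstate -> mem -> tstate -> option resp -> Prop :=
| ts_invoke m o : tstep m Idle m (Busy (start o)) None
| ts_internal m s m' s' : exec m s = (m', inl s') -> tstep m (Busy s) m' (Busy s') None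
| ts_return m s m' r : exec m s = (m', inr r) -> tstep m (Busy s) m' Idle (Some r).

Record config := mkConfig { cmem : mem; cthr : nat -> tstate }.
Definition init_config : config := mkConfig init_mem (fun _ => Idle).

Definition sys_step (N : nat) (c c' : config) (l : option resp) : Prop :=
  exists t, t < N /\ tstep (cmem c) (cthr c t) (cmem c') (cthr c' t) l /\
            forall u, u <> t -> cthr c' u = cthr c u.

Definition is_execution (N : nat) (e : nat -> config) (l : nat -> option resp) : Prop :=
  e 0 = init_config /\ forall n, sys_step N (e n) (e (S n)) (l n).

Definition lock_free (N : nat) : Prop :=
  forall e l, is_execution N e l ->
    forall n, exists m, n <= m /\ l m <> None.

(* Main.v *)
From Stdlib Require Import ZArith Bool List Arith Lia Classical Wellfounded.
From Stdlib Require Import Relation_Operators.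
Import ListNotations.
Require Import Defs.

(* In a suffix without completed operations each thread can still link, mark and
   increment the clock only boundedly often.  A trimming CAS that succeeds unlinks
   at least one marked node, because a flagged node that is still in the list
   always has a marked predecessor; each flagging consumes an unfrozen node, and
   no node outside the list is unfrozen; each time stamp is written once.  So the
   nodes that were ever linked eventually stop changing.  Once they
   are static, a fresh traversal would succeed in any list CAS it attempts, so it
   attempts none.
   A range query advances because the prior-chain behind the successor of a node
   [x] consists of the former successors of [x], all with larger keys, back to one
   that was stamped before [x] was linked; and its restarts search for strictly
   decreasing keys. *)

(** * Keys and pointers *)

(** A traversal may stand on a node that has already been unlinked, so order, freezing and stamp
    facts are kept for every node ever linked; only the shape of the list and the flag condition are
    restricted to the nodes still in it. A flagged node in the list has a marked predecessor because
    a flag is set only at the end of a nonempty path of marked nodes, and this predecessor is then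
    frozen, so nothing can be linked in between. The last obstacle is that a thread may hold values
    read before the memory became static, so its next CAS may still fail. Hence fresh traversals are
    shown to terminate before arbitrary program counters are treated; one set of lemmas serves both
    purposes. *)

Definition klt (a b : ekey) : Prop := ekey_lt a b = true.

Ltac key_solve :=
  intros; unfold klt, ekey_eqb, ekey_le, ekey_lt in *;
  repeat match goal with k : ekey |- _ => destruct k end;
  cbn in *; rewrite ?andb_true_iff, ?negb_true_iff, ?Z.ltb_lt, ?Z.ltb_ge in *;
  try congruence; try lia.

Lemma klt_trans a b c : klt a b -> klt b c -> klt a c.
Proof. key_solve. Qed.

Lemma klt_irrefl a : ~ klt a a.
Proof. key_solve. Qed.

Lemma ekey_le_false a b : ekey_le a b = false -> klt b a.
Proof. unfold ekey_le, klt. destruct (ekey_lt b a); auto. Qed.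

Lemma ekey_eqb_eq a b : ekey_eqb a b = true -> a = b.
Proof. key_solve. f_equal; lia. Qed.

Lemma ekey_eqb_false_klt a b : ekey_eqb b a = false -> ekey_le a b = true -> klt a b.
Proof.
  unfold ekey_eqb. intros H1 H2. rewrite H2, andb_true_r in H1.
  now apply ekey_le_false.
Qed.

Lemma klt_neq_PosInf a b : klt a b -> a <> KPosInf.
Proof. key_solve. Qed.

Lemma ekey_le_PosInf a : ekey_le a KPosInf = true.
Proof. key_solve; destruct a; reflexivity. Qed.

Lemma ptr_eqb_eq p q : ptr_eqb p q = true <-> p = q.
Proof.
  unfold ptr_eqb. destruct p as [a b c], q as [a' b' c']; cbn.
  rewrite !andb_true_iff, Nat.eqb_eq, !Bool.eqb_true_iff.
  split; [intros [[-> ->] ->]; auto | intros [= -> -> ->]; auto].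
Qed.

Lemma unfrozen_plain p : marked_or_flagged p = false -> p = plain (pref p).
Proof. destruct p as [a [] []]; (discriminate || reflexivity). Qed.

Lemma pmark_frozen p : pmark p = true -> marked_or_flagged p = true.
Proof. unfold marked_or_flagged. now intros ->. Qed.

Lemma pflag_frozen p : pflag p = true -> marked_or_flagged p = true.
Proof. unfold marked_or_flagged. intros ->. apply orb_true_r. Qed.

Lemma unfrozen_bits p :
  marked_or_flagged p = false <-> pmark p = false /\ pflag p = false.
Proof. apply orb_false_iff. Qed.

(** * Ghost state and the invariant of the shared memory *)

(* [pub]: the nodes that were ever linked into the list, [dead]: those unlinked
   since, [born]: the value of the clock when the node was linked. *)
Record ghost := mkGhost { pub : list nat; dead : list nat; born : nat -> nat }.

Definition live (G : ghost) (a : nat) : Prop := In a (pub G) /\ ~ In a (dead G).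

Definition frozen (m : mem) (a : nat) : Prop :=
  marked_or_flagged (next (heap m a)) = true.

Definition set_ts (m : mem) (a : nat) : Prop := ts (heap m a) <> BOT.

Definition succ_of (m : mem) (a : nat) : nat := pref (next (heap m a)).

(* The prior-chain of [s] runs through nodes with larger keys than [x] until it
   meets a node that was already stamped when [x] was linked: this is why a
   range query standing at [x] moves to a strictly larger key. *)
Inductive chain (G : ghost) (m : mem) (x : nat) : nat -> Prop :=
| chain_base s : In s (pub G) -> klt (key (heap m x)) (key (heap m s)) ->
    set_ts m s -> ts (heap m s) <= born G x -> chain G m x s
| chain_step s : In s (pub G) -> klt (key (heap m x)) (key (heap m s)) ->
    chain G m x (prior (heap m s)) -> chain G m x s.

(** Fields [g_*] concern every node ever linked, fields [l_*] its relation to the current list. In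
    [g_prior] the decreasing address makes walks along [prior] well founded; the alternative, a
    stamp of 2, covers the two initial nodes, where such walks stop because the bound of a range
    query is never below 2. [g_null] speaks of keys and not of [TAIL] because trimming may replace
    the tail by a copy. By [l_mark] a marked node is not unlinked without its successor, so the
    marked node in front of a live one is still in the list. *)
Record ginv (G : ghost) (m : mem) : Prop := {
  g_head : In HEAD (pub G) /\ key (heap m HEAD) = KNegInf /\
           ts (heap m HEAD) = 2 /\ ~ frozen m HEAD;
  g_alloc : forall a, In a (pub G) -> a < nextFree m /\ a <> NULL;
  g_glob : 2 <= globalTS m;
  g_succ : forall a, In a (pub G) -> succ_of m a <> NULL ->
    In (succ_of m a) (pub G) /\ klt (key (heap m a)) (key (heap m (succ_of m a)));
  g_null : forall a, In a (pub G) -> (succ_of m a = NULL <-> key (heap m a) = KPosInf);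
  g_bits : forall a, In a (pub G) ->
    pmark (next (heap m a)) = true -> pflag (next (heap m a)) = false;
  g_mark : forall a, In a (pub G) ->
    pmark (next (heap m a)) = true -> succ_of m a <> NULL;
  g_frozen : forall a, In a (pub G) -> frozen m a -> set_ts m a;
  g_past : forall a, In a (pub G) -> born G a <= globalTS m;
  g_born : forall a, In a (pub G) -> set_ts m a ->
    born G a <= ts (heap m a) <= globalTS m;
  g_prior : forall a, In a (pub G) -> ts (heap m a) = 2 \/
    (In (prior (heap m a)) (pub G) /\ prior (heap m a) < a /\ set_ts m (prior (heap m a)));
  g_chain : forall a, In a (pub G) -> succ_of m a <> NULL -> chain G m a (succ_of m a);
  g_dead : forall a, In a (dead G) -> In a (pub G);
  l_head : ~ In HEAD (dead G);
  l_succ : forall a, live G a -> succ_of m a <> NULL -> live G (succ_of m a);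
  l_uniq : forall a b, live G a -> live G b -> succ_of m a = succ_of m b ->
    succ_of m a <> NULL -> a = b;
  l_dead : forall a, In a (pub G) -> ~ frozen m a -> ~ In a (dead G);
  l_flag : forall a, live G a -> succ_of m a <> NULL ->
    pflag (next (heap m (succ_of m a))) = true -> pmark (next (heap m a)) = true;
  l_mark : forall a, In a (pub G) -> pmark (next (heap m a)) = true ->
    live G (succ_of m a) -> ~ In a (dead G)
}.

(* What a step leaves unchanged for the other threads; [o] is the private node
   that the stepping thread may link. *)
Record ext (G : ghost) (m : mem) (G' : ghost) (m' : mem) (o : option nat) : Prop := {
  e_pub : forall a, In a (pub G) -> In a (pub G');
  e_key : forall a, In a (pub G) -> key (heap m' a) = key (heap m a);
  e_prior : forall a, In a (pub G) -> prior (heap m' a) = prior (heap m a);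
  e_ts : forall a, In a (pub G) -> set_ts m a -> ts (heap m' a) = ts (heap m a);
  e_frozen : forall a, In a (pub G) -> frozen m a -> next (heap m' a) = next (heap m a);
  e_born : forall a, In a (pub G) -> born G' a = born G a;
  e_glob : globalTS m <= globalTS m';
  e_free : nextFree m <= nextFree m';
  e_priv : forall a, ~ In a (pub G) -> a < nextFree m -> o <> Some a ->
    ~ In a (pub G') /\ heap m' a = heap m a
}.

Lemma ext_refl G m o : ext G m G m o.
Proof. constructor; auto. Qed.

Lemma ext_set_ts G m G' m' o a : ext G m G' m' o ->
  In a (pub G) -> set_ts m a -> set_ts m' a.
Proof. intros E H1 H2. unfold set_ts. now rewrite (e_ts _ _ _ _ _ E a H1 H2). Qed.

Lemma ext_chain G m G' m' o x s : ext G m G' m' o -> In x (pub G) ->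
  chain G m x s -> chain G' m' x s.
Proof.
  intros E Hx H. induction H as [s Hs Hk Ht Hb | s Hs Hk _ IH].
  - apply chain_base; [eapply e_pub; eauto| | |].
    + now rewrite !(e_key _ _ _ _ _ E) by auto.
    + eapply ext_set_ts; eauto.
    + rewrite (e_ts _ _ _ _ _ E), (e_born _ _ _ _ _ E); auto.
  - apply chain_step; [eapply e_pub; eauto| |].
    + now rewrite !(e_key _ _ _ _ _ E) by auto.
    + now rewrite (e_prior _ _ _ _ _ E).
Qed.

(* Paths of marked nodes, listed backwards without the end point. *)
Inductive mpath (G : ghost) (m : mem) (a : nat) : list nat -> nat -> Prop :=
| mp_nil : In a (pub G) -> mpath G m a [] a
| mp_snoc l b : mpath G m a l b -> pmark (next (heap m b)) = true ->
    mpath G m a (b :: l) (succ_of m b).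

(** * Thread invariants *)

(** The clock value [t] was read after [a] had been linked; writing it as a stamp therefore respects
    [born], and the bound 2 keeps it apart from [BOT]. *)
Definition pend (G : ghost) (m : mem) (a t : nat) : Prop :=
  In a (pub G) /\ born G a <= t /\ 2 <= t <= globalTS m.

(** A range query has already incremented a clock of at least 2, so a refreshed bound
    [globalTS m - 1] is again at least 2. *)
Definition fc_ok (m : mem) (fk : ekey) (fc : fcont) : Prop :=
  match fc with
  | KIns k _ | KRem1 k => fk = KFin k
  | KRQ _ _ t => 2 <= t /\ 3 <= globalTS m
  | _ => True
  end.

(** [HEAD] is listed separately because [fk] has no general lower bound: [KNegInf] need not lie
    strictly below it. *)
Definition pred_ok (G : ghost) (m : mem) (fk : ekey) (pred : nat) : Prop :=
  In pred (pub G) /\ (klt (key (heap m pred)) fk \/ pred = HEAD).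

(** The last disjunct is kept for the comparison of [pn] with [curr]: if they differ, the first
    skipped node, which becomes the victim, is frozen. *)
Definition scan (G : ghost) (m : mem) (fk : ekey) (fc : fcont)
    (pred : nat) (pn : ptr) (curr : nat) : Prop :=
  fc_ok m fk fc /\ pred_ok G m fk pred /\ marked_or_flagged pn = false /\
  In (pref pn) (pub G) /\ In curr (pub G) /\ (curr = pref pn \/ frozen m (pref pn)).

Definition after_scan (G : ghost) (m : mem) (fk : ekey) (fc : fcont) (pred : nat) : Prop :=
  fc_ok m fk fc /\ pred_ok G m fk pred /\ set_ts m pred.

Definition trimming (G : ghost) (m : mem) (fk : ekey) (fc : fcont)
    (pred victim curr : nat) : Prop :=
  after_scan G m fk fc pred /\ In victim (pub G) /\ frozen m victim /\
  In curr (pub G) /\ exists l, mpath G m victim l curr.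

Definition found (G : ghost) (m : mem) (fk : ekey) (fc : fcont) (pred curr : nat) : Prop :=
  after_scan G m fk fc pred /\ In curr (pub G) /\ ekey_le fk (key (heap m curr)) = true.

Definition private (G : ghost) (m : mem) (n : nat) (k : ekey) (sc pr : nat) : Prop :=
  ~ In n (pub G) /\ n < nextFree m /\ n <> NULL /\ pr < n /\
  ts (heap m n) = BOT /\ key (heap m n) = k /\ next (heap m n) = plain sc /\
  prior (heap m n) = pr.

Definition inserting (G : ghost) (m : mem) (k : Z) (pred curr : nat) : Prop :=
  In pred (pub G) /\ In curr (pub G) /\ set_ts m curr /\
  klt (key (heap m pred)) (KFin k) /\ klt (KFin k) (key (heap m curr)).

Definition removing (G : ghost) (m : mem) (k : Z) (curr : nat) : Prop :=
  In curr (pub G) /\ set_ts m curr /\ key (heap m curr) = KFin k.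

Definition visited (G : ghost) (m : mem) (t curr : nat) : Prop :=
  2 <= t /\ In curr (pub G) /\ set_ts m curr.

Definition at_time (G : ghost) (m : mem) (t curr : nat) : Prop :=
  visited G m t curr /\ ts (heap m curr) <= t.

Definition flagged_succ (m : mem) (curr sc : nat) : Prop :=
  pflag (next (heap m curr)) = true /\ sc = succ_of m curr.

Definition tinv (G : ghost) (m : mem) (s : pc) : Prop :=
  match s with
  | F_Retry fk fc => fc_ok m fk fc
  | F_While fk fc pred pn curr => scan G m fk fc pred pn curr
  | F_NullTest fk fc pred pn curr => scan G m fk fc pred pn curr /\ frozen m curr
  | F_Step fk fc pred pn curr =>
      scan G m fk fc pred pn curr /\ frozen m curr /\ succ_of m curr <> NULL
  | F_KeyTest fk fc pred pn curr => scan G m fk fc pred pn curr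
  | F_Adv fk fc pred => fc_ok m fk fc /\ In pred (pub G) /\ klt (key (heap m pred)) fk
  | F_PredTs1 fk fc pred pn curr =>
      scan G m fk fc pred pn curr /\ ekey_le fk (key (heap m curr)) = true
  | F_PredTs2 fk fc pred pn curr t =>
      scan G m fk fc pred pn curr /\ ekey_le fk (key (heap m curr)) = true /\ pend G m pred t
  | F_AfterTrim fk fc pred => after_scan G m fk fc pred
  | F_Check fk fc pred curr => after_scan G m fk fc pred /\ In curr (pub G)
  | F_CurrTs1 fk fc pred curr => found G m fk fc pred curr
  | F_CurrTs2 fk fc pred curr t => found G m fk fc pred curr /\ pend G m curr t
  | T_While fk fc pred victim curr => trimming G m fk fc pred victim curr
  | T_Step fk fc pred victim curr =>
      trimming G m fk fc pred victim curr /\ pmark (next (heap m curr)) = true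
  | T_Ts1 fk fc pred victim curr => trimming G m fk fc pred victim curr
  | T_Ts2 fk fc pred victim curr t => trimming G m fk fc pred victim curr /\ pend G m curr t
  | T_Flag1 fk fc pred victim curr => trimming G m fk fc pred victim curr /\ set_ts m curr
  | T_Flag2 fk fc pred victim curr p =>
      trimming G m fk fc pred victim curr /\ set_ts m curr /\ marked_or_flagged p = false
  | T_FlagFail fk fc pred victim curr =>
      trimming G m fk fc pred victim curr
  | T_Succ fk fc pred victim curr =>
      trimming G m fk fc pred victim curr /\ pflag (next (heap m curr)) = true
  | T_SuccTs1 fk fc pred victim curr sc =>
      trimming G m fk fc pred victim curr /\ flagged_succ m curr sc /\ sc <> NULL
  | T_SuccTs2 fk fc pred victim curr sc t =>
      trimming G m fk fc pred victim curr /\ flagged_succ m curr sc /\ pend G m sc t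
  | T_Alloc fk fc pred victim curr sc =>
      trimming G m fk fc pred victim curr /\ flagged_succ m curr sc /\
      (sc <> NULL -> set_ts m sc)
  | T_Cas fk fc pred victim nc =>
      exists curr sc, trimming G m fk fc pred victim curr /\ flagged_succ m curr sc /\
      (sc <> NULL -> set_ts m sc) /\ private G m nc (key (heap m curr)) sc victim
  | T_NewTs1 fk fc pred nc => after_scan G m fk fc pred /\ In nc (pub G)
  | T_NewTs2 fk fc pred nc t => after_scan G m fk fc pred /\ pend G m nc t
  | I_Alloc k v pred curr => inserting G m k pred curr
  | I_Cas k v pred curr n => inserting G m k pred curr /\ private G m n (KFin k) curr curr
  | I_Ts1 n => In n (pub G)
  | I_Ts2 n t => pend G m n t
  | R_Mark1 k curr => removing G m k curr
  | R_Mark2 k curr p => removing G m k curr /\ marked_or_flagged p = false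
  | Q_Start _ _ => True
  | Q_Back low high t ck pred curr => visited G m t pred /\ 3 <= globalTS m
  | Q_Refresh _ _ _ => 3 <= globalTS m
  | Q_Low low high t curr => at_time G m t curr
  | Q_LNext low high t curr => at_time G m t curr /\ key (heap m curr) <> KPosInf
  | Q_LTs1 low high t sc => 2 <= t /\ In sc (pub G)
  | Q_LTs2 low high t sc g => 2 <= t /\ pend G m sc g
  | Q_LBack low high t sc => visited G m t sc
  | Q_Col low high t curr acc => at_time G m t curr
  | Q_CNext low high t curr acc => at_time G m t curr /\ key (heap m curr) <> KPosInf
  | Q_CTs1 low high t sc acc => 2 <= t /\ In sc (pub G)
  | Q_CTs2 low high t sc g acc => 2 <= t /\ pend G m sc g
  | Q_CBack low high t sc acc => visited G m t sc
  end.

Definition own (s : pc) : option nat :=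
  match s with
  | T_Cas _ _ _ _ nc => Some nc
  | I_Cas _ _ _ _ n => Some n
  | _ => None
  end.

(** * Stability of the thread invariants under steps of other threads *)

Lemma mpath_pub G m a l c : ginv G m -> mpath G m a l c ->
  In c (pub G) /\ In a (pub G) /\ forall x, In x l -> In x (pub G).
Proof.
  intros I H. induction H as [Ha | l b H (IH1 & IH2 & IH3) Hb].
  - repeat split; auto. intros x [].
  - repeat split; auto.
    + apply (g_succ _ _ I); auto. now apply (g_mark _ _ I).
    + intros x [<- | Hx]; auto.
Qed.

Lemma ext_mpath G m G' m' o a l c : ginv G m -> ext G m G' m' o ->
  mpath G m a l c -> mpath G' m' a l c.
Proof.
  intros I E H. induction H as [Ha | l b H IH Hb].
  - apply mp_nil. eapply e_pub; eauto.
  - destruct (mpath_pub _ _ _ _ _ I H) as [Hp _].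
    assert (Hn : next (heap m' b) = next (heap m b)).
    { apply (e_frozen _ _ _ _ _ E); auto. now apply pmark_frozen. }
    unfold succ_of. rewrite <- Hn. apply mp_snoc; auto. now rewrite Hn.
Qed.

Ltac splits := repeat match goal with |- _ /\ _ => split end.

Lemma ext_frozen G m G' m' o a : ext G m G' m' o ->
  In a (pub G) -> frozen m a -> frozen m' a.
Proof. intros E H1 H2. unfold frozen. now rewrite (e_frozen _ _ _ _ _ E a H1 H2). Qed.

Lemma ext_pend G m G' m' o a t : ext G m G' m' o -> pend G m a t -> pend G' m' a t.
Proof.
  intros E (H1 & H2 & H3 & H4). unfold pend.
  rewrite (e_born _ _ _ _ _ E) by auto.
  pose proof (e_glob _ _ _ _ _ E). splits; auto; try lia. eapply e_pub; eauto.
Qed.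

Lemma ext_fc_ok G m G' m' o fk fc : ext G m G' m' o -> fc_ok m fk fc -> fc_ok m' fk fc.
Proof. intros E. pose proof (e_glob _ _ _ _ _ E). destruct fc; cbn; auto. lia. Qed.

Lemma ext_pred_ok G m G' m' o fk p : ext G m G' m' o -> pred_ok G m fk p -> pred_ok G' m' fk p.
Proof.
  intros E [H1 H2]. split; [eapply e_pub; eauto|].
  now rewrite (e_key _ _ _ _ _ E).
Qed.

Lemma ext_scan G m G' m' o fk fc pred pn curr : ext G m G' m' o ->
  scan G m fk fc pred pn curr -> scan G' m' fk fc pred pn curr.
Proof.
  intros E (H1 & H2 & H3 & H4 & H5 & H6). unfold scan. splits; auto.
  - eapply ext_fc_ok; eauto.
  - eapply ext_pred_ok; eauto.
  - eapply e_pub; eauto.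
  - eapply e_pub; eauto.
  - destruct H6; [auto | right; eapply ext_frozen; eauto].
Qed.

Lemma ext_after_scan G m G' m' o fk fc pred : ext G m G' m' o ->
  after_scan G m fk fc pred -> after_scan G' m' fk fc pred.
Proof.
  intros E (H1 & H2 & H3). unfold after_scan. splits.
  - eapply ext_fc_ok; eauto.
  - eapply ext_pred_ok; eauto.
  - destruct H2. eapply ext_set_ts; eauto.
Qed.

Lemma ext_trimming G m G' m' o fk fc pred victim curr : ginv G m -> ext G m G' m' o ->
  trimming G m fk fc pred victim curr -> trimming G' m' fk fc pred victim curr.
Proof.
  intros I E (H1 & H2 & H3 & H4 & l & H5). unfold trimming. splits.
  - eapply ext_after_scan; eauto.
  - eapply e_pub; eauto.
  - eapply ext_frozen; eauto.
  - eapply e_pub; eauto.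
  - exists l. eapply ext_mpath; eauto.
Qed.

Lemma ext_found G m G' m' o fk fc pred curr : ext G m G' m' o ->
  found G m fk fc pred curr -> found G' m' fk fc pred curr.
Proof.
  intros E (H1 & H2 & H3). unfold found. splits.
  - eapply ext_after_scan; eauto.
  - eapply e_pub; eauto.
  - now rewrite (e_key _ _ _ _ _ E).
Qed.

Lemma ext_inserting G m G' m' o k pred curr : ext G m G' m' o ->
  inserting G m k pred curr -> inserting G' m' k pred curr.
Proof.
  intros E (H1 & H2 & H3 & H4 & H5). unfold inserting.
  rewrite !(e_key _ _ _ _ _ E) by auto.
  splits; auto; try (eapply e_pub; eauto). eapply ext_set_ts; eauto.
Qed.

Lemma ext_removing G m G' m' o k curr : ext G m G' m' o ->
  removing G m k curr -> removing G' m' k curr.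
Proof.
  intros E (H1 & H2 & H3). unfold removing.
  rewrite !(e_key _ _ _ _ _ E) by auto.
  splits; auto; try (eapply e_pub; eauto). eapply ext_set_ts; eauto.
Qed.

Lemma ext_visited G m G' m' o t a : ext G m G' m' o -> visited G m t a -> visited G' m' t a.
Proof.
  intros E (H1 & H2 & H3). unfold visited.
  splits; auto; try (eapply e_pub; eauto). eapply ext_set_ts; eauto.
Qed.

Lemma ext_at_time G m G' m' o t a : ext G m G' m' o -> at_time G m t a -> at_time G' m' t a.
Proof.
  intros E [H1 H2]. split; [eapply ext_visited; eauto|].
  destruct H1 as (? & ? & ?). now rewrite (e_ts _ _ _ _ _ E).
Qed.

Lemma ext_flagged_succ G m G' m' o a b : ext G m G' m' o -> In a (pub G) ->
  flagged_succ m a b -> flagged_succ m' a b.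
Proof.
  intros E Ha [H1 H2]. unfold flagged_succ, succ_of in *.
  now rewrite (e_frozen _ _ _ _ _ E) by (auto; now apply pflag_frozen).
Qed.

Lemma ext_private G m G' m' o n k sc pr : ext G m G' m' o -> o <> Some n ->
  private G m n k sc pr -> private G' m' n k sc pr.
Proof.
  intros E Ho (H1 & H2 & H3). unfold private.
  destruct (e_priv _ _ _ _ _ E n H1 H2 Ho) as [H4 ->].
  pose proof (e_free _ _ _ _ _ E). splits; auto; try lia; apply H3.
Qed.

Lemma ext_next_pflag G m G' m' o a : ext G m G' m' o -> In a (pub G) ->
  pflag (next (heap m a)) = true -> pflag (next (heap m' a)) = true.
Proof. intros E H1 H2. rewrite (e_frozen _ _ _ _ _ E); auto. now apply pflag_frozen. Qed.

Lemma ext_next_pmark G m G' m' o a : ext G m G' m' o -> In a (pub G) ->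
  pmark (next (heap m a)) = true -> pmark (next (heap m' a)) = true.
Proof. intros E H1 H2. rewrite (e_frozen _ _ _ _ _ E); auto. now apply pmark_frozen. Qed.

Lemma ext_succ_ts G m G' m' o a sc : ginv G m -> ext G m G' m' o -> In a (pub G) ->
  flagged_succ m a sc -> (sc <> NULL -> set_ts m sc) -> sc <> NULL -> set_ts m' sc.
Proof.
  intros I E Ha [Hf ->] H Hn. eapply ext_set_ts; eauto. now apply (g_succ _ _ I).
Qed.

Create HintDb ext.
#[export] Hint Resolve ext_set_ts ext_frozen ext_pend ext_fc_ok ext_pred_ok ext_scan
  ext_after_scan ext_trimming ext_found ext_inserting ext_removing ext_visited ext_at_time
  ext_flagged_succ ext_private ext_next_pflag ext_next_pmark e_pub : ext.

(** A thread relies on the others only through [ext]; the side condition on [own] keeps its private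
    node apart from the node that the step may link. *)
Lemma ext_tinv G m G' m' o s : ginv G m -> ext G m G' m' o ->
  (forall a, own s = Some a -> o <> Some a) -> tinv G m s -> tinv G' m' s.
Proof.
  intros I E Ho H. pose proof (e_glob _ _ _ _ _ E) as Hg.
  destruct s; cbn in *;
    try (decompose [and] H; splits; eauto 3 with ext; try lia; fail).
  - destruct H as (H1 & H2). pose proof H1 as (_ & _ & _ & _ & Hc & _). splits; eauto with ext.
  - destruct H as (H1 & H2 & H3). pose proof H1 as (_ & _ & _ & _ & Hc & _). splits; eauto with ext.
    unfold succ_of in *. rewrite (e_frozen _ _ _ _ _ E); auto.
  - destruct H as (H1 & H2 & H3). splits; eauto with ext.
    now rewrite (e_key _ _ _ _ _ E).
  - destruct H as (H1 & H2). splits; eauto with ext.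
    rewrite (e_key _ _ _ _ _ E); auto. apply H1.
  - destruct H as (H1 & H2 & H3). splits; eauto with ext.
    rewrite (e_key _ _ _ _ _ E); auto. apply H1.
  - destruct H as (H1 & H2). pose proof H1 as (_ & _ & _ & Hc & _). splits; eauto with ext.
  - destruct H as (H1 & H2). pose proof H1 as (_ & _ & _ & Hc & _). splits; eauto with ext.
  - destruct H as (H1 & H2 & H3). pose proof H1 as (_ & _ & _ & Hc & _). splits; eauto with ext.
  - destruct H as (H1 & H2). pose proof H1 as (_ & _ & _ & Hc & _). splits; eauto with ext.
  - destruct H as (H1 & H2 & H3). pose proof H1 as (_ & _ & _ & Hc & _). splits; eauto with ext.
  - destruct H as (H1 & H2 & H3). pose proof H1 as (_ & _ & _ & Hc & _). splits; eauto with ext.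
  - destruct H as (H1 & H2 & H3). pose proof H1 as (_ & _ & _ & Hc & _). splits; eauto with ext.
    eapply ext_succ_ts; eauto.
  - destruct H as (c & sc & H1 & H2 & H3 & H4). pose proof H1 as (_ & _ & _ & Hc & _).
    exists c, sc. splits; eauto with ext.
    + eapply ext_succ_ts; eauto.
    + rewrite (e_key _ _ _ _ _ E); auto. eapply ext_private; eauto.
  - destruct H as [H1 H2]. splits; eauto with ext.
    rewrite (e_key _ _ _ _ _ E); auto. apply H1.
  - destruct H as [H1 H2]. splits; eauto with ext.
    rewrite (e_key _ _ _ _ _ E); auto. apply H1.
Qed.

(** * The measure *)

Definition count (f : nat -> bool) (l : list nat) : nat := length (filter f l).

Lemma count_le f g l : (forall a, In a l -> f a = true -> g a = true) ->
  count f l <= count g l.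
Proof.
  unfold count. induction l as [|a l IH]; cbn; intros H; auto.
  assert (IH' : length (filter f l) <= length (filter g l)) by auto.
  destruct (f a) eqn:Ef; [rewrite (H a) by auto; cbn; lia|].
  destruct (g a); cbn; lia.
Qed.

Lemma count_lt f g l a : (forall x, In x l -> f x = true -> g x = true) ->
  In a l -> f a = false -> g a = true -> count f l < count g l.
Proof.
  unfold count. induction l as [|b l IH]; cbn; intros H Ha Hf Hg; [tauto|].
  assert (Hle : count f l <= count g l) by (apply count_le; auto). unfold count in Hle.
  destruct Ha as [-> | Ha].
  - rewrite Hf, Hg. cbn. lia.
  - assert (IH' : length (filter f l) < length (filter g l)) by auto.
    destruct (f b) eqn:Ef; [rewrite (H b) by auto; cbn; lia|].
    destruct (g b); cbn; lia.
Qed.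

Lemma count_ext f g l : (forall a, In a l -> f a = g a) -> count f l = count g l.
Proof. intros H. unfold count. f_equal. now apply filter_ext_in. Qed.

Definition deadb (G : ghost) (a : nat) : bool :=
  if in_dec Nat.eq_dec a (dead G) then true else false.

Definition marked_live (G : ghost) (m : mem) : nat :=
  count (fun a => negb (deadb G a) && pmark (next (heap m a))) (pub G).
Definition unfrozen_pub (G : ghost) (m : mem) : nat :=
  count (fun a => negb (marked_or_flagged (next (heap m a)))) (pub G).
Definition unset_pub (G : ghost) (m : mem) : nat :=
  count (fun a => Nat.eqb (ts (heap m a)) BOT) (pub G).

(** Lexicographic because a trimming links a fresh node that is neither frozen nor stamped: it
    raises the last two counts and is paid for by the first. Flagging keeps the first count,
    stamping the first two. Insertions and markings may raise this measure; [weight] pays for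
    them. *)
Definition measure_decr (G : ghost) (m : mem) (G' : ghost) (m' : mem) : Prop :=
  marked_live G' m' < marked_live G m \/
  marked_live G' m' = marked_live G m /\
  (unfrozen_pub G' m' < unfrozen_pub G m \/
   unfrozen_pub G' m' = unfrozen_pub G m /\ unset_pub G' m' < unset_pub G m).

(** Only linked nodes are compared, so allocating a private node is quiet. *)
Definition quiet (G : ghost) (m : mem) (G' : ghost) (m' : mem) : Prop :=
  G' = G /\ forall a, In a (pub G) -> heap m' a = heap m a.

(** * Effect of the atomic operations on the invariant *)

Lemma ext_same G m m' o : (forall a, In a (pub G) -> heap m' a = heap m a) ->
  globalTS m <= globalTS m' -> nextFree m <= nextFree m' ->
  (forall a, a < nextFree m -> heap m' a = heap m a) -> ext G m G m' o.
Proof. intros H1 H2 H3 H4. constructor; intros; auto; now rewrite H1. Qed.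

Lemma ginv_same G m m' o : ext G m G m' o ->
  (forall a, In a (pub G) -> heap m' a = heap m a) -> ginv G m -> ginv G m'.
Proof.
  intros E Hs I.
  assert (Hsc : forall a, In a (pub G) -> succ_of m' a = succ_of m a)
    by (intros; unfold succ_of; now rewrite Hs).
  assert (Hp : forall a, In a (pub G) -> succ_of m a <> NULL -> In (succ_of m a) (pub G))
    by (intros; now apply (g_succ _ _ I)).
  pose proof (e_glob _ _ _ _ _ E). pose proof (e_free _ _ _ _ _ E).
  constructor; unfold frozen, set_ts in *; intros.
  - destruct (g_head _ _ I) as [Hh ?]. now rewrite Hs.
  - destruct (g_alloc _ _ I a); auto. lia.
  - pose proof (g_glob _ _ I). lia.
  - rewrite !Hsc in * by auto. rewrite !Hs by auto. now apply (g_succ _ _ I).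
  - rewrite Hsc, Hs by auto. now apply (g_null _ _ I).
  - rewrite Hs in * by auto. now apply (g_bits _ _ I).
  - rewrite Hsc, Hs in * by auto. now apply (g_mark _ _ I).
  - rewrite Hs in * by auto. now apply (g_frozen _ _ I).
  - pose proof (g_past _ _ I a). intuition lia.
  - rewrite Hs in * by auto. pose proof (g_born _ _ I a). unfold set_ts in *. intuition lia.
  - rewrite Hs by auto. destruct (g_prior _ _ I a) as [|(?&?&?)]; auto.
    right. rewrite Hs by auto. auto.
  - rewrite Hsc in * by auto. eapply ext_chain; eauto. now apply (g_chain _ _ I).
  - now apply (g_dead _ _ I).
  - apply (l_head _ _ I).
  - pose proof H1 as [Ha _]. rewrite Hsc in * by auto. now apply (l_succ _ _ I).
  - pose proof H1 as [Ha _]. pose proof H2 as [Hb _]. rewrite !Hsc in * by auto.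
    now apply (l_uniq _ _ I).
  - rewrite Hs in * by auto. now apply (l_dead _ _ I).
  - pose proof H1 as [Ha _]. rewrite Hsc in * by auto. rewrite Hs in * by auto.
    now apply (l_flag _ _ I).
  - rewrite Hsc, Hs in * by auto. now apply (l_mark _ _ I).
Qed.

Lemma ginv_alloc G m n o : ginv G m ->
  ginv G (fst (alloc m n)) /\ ext G m G (fst (alloc m n)) o /\
  quiet G m G (fst (alloc m n)).
Proof.
  intros I.
  assert (H : forall a, a < nextFree m -> heap (fst (alloc m n)) a = heap m a).
  { intros a Ha. cbn. destruct (Nat.eqb_spec a (nextFree m)); auto; lia. }
  assert (H' : forall a, In a (pub G) -> heap (fst (alloc m n)) a = heap m a).
  { intros a Ha. apply H. now apply (g_alloc _ _ I). }
  assert (E : ext G m G (fst (alloc m n)) o) by (apply ext_same; auto; cbn; lia).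
  splits; auto; [eapply ginv_same; eauto | split; auto].
Qed.

Lemma ginv_fetch G m o : ginv G m ->
  ginv G (fst (fetch_add_ts m)) /\ ext G m G (fst (fetch_add_ts m)) o.
Proof.
  intros I.
  assert (E : ext G m G (fst (fetch_add_ts m)) o) by (apply ext_same; auto; cbn; lia).
  split; auto. eapply ginv_same; eauto.
Qed.

Lemma quiet_refl G m : quiet G m G m.
Proof. split; auto. Qed.

(** A failed CAS means that the stamp had been written before, so [a] is stamped in either case. *)
Lemma ginv_cas_ts G m a t m' b o : ginv G m -> pend G m a t -> cas_ts m a t = (m', b) ->
  ginv G m' /\ ext G m G m' o /\ set_ts m' a /\
  (measure_decr G m G m' \/ quiet G m G m').
Proof.
  intros I (Ha & Hb & Ht1 & Ht2) Hc. unfold cas_ts in Hc.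
  destruct (Nat.eqb_spec (ts (heap m a)) BOT) as [Hbot | Hbot]; injection Hc as <- <-;
    [|splits; auto using ext_refl, quiet_refl].
  set (m' := set_node m a (with_ts (heap m a) t)).
  assert (Hk : forall x, key (heap m' x) = key (heap m x))
    by (intros x; cbn; destruct (Nat.eqb_spec x a) as [-> |]; reflexivity).
  assert (Hn : forall x, next (heap m' x) = next (heap m x))
    by (intros x; cbn; destruct (Nat.eqb_spec x a) as [-> |]; reflexivity).
  assert (Hp : forall x, prior (heap m' x) = prior (heap m x))
    by (intros x; cbn; destruct (Nat.eqb_spec x a) as [-> |]; reflexivity).
  assert (Hs : forall x, succ_of m' x = succ_of m x) by (intros; unfold succ_of; now rewrite Hn).
  assert (Hts : forall x, set_ts m x -> ts (heap m' x) = ts (heap m x)).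
  { intros x Hx. cbn. destruct (Nat.eqb_spec x a) as [-> |]; auto. contradiction. }
  assert (Hset : forall x, set_ts m x -> set_ts m' x)
    by (intros x Hx; unfold set_ts; now rewrite Hts).
  assert (Hta : ts (heap m' a) = t) by (cbn; rewrite Nat.eqb_refl; reflexivity).
  assert (Hx : forall x, x <> a -> heap m' x = heap m x)
    by (intros x Hne; cbn; destruct (Nat.eqb_spec x a); congruence).
  assert (E : ext G m G m' o).
  { constructor; intros; auto. split; auto. apply Hx. congruence. }
  assert (Hseta : set_ts m' a) by (unfold set_ts, BOT; rewrite Hta; lia).
  splits; auto.
  - constructor; unfold frozen in *; intros; rewrite ?Hk, ?Hn, ?Hs in *.
    + destruct (g_head _ _ I) as (H1 & H2 & H3 & H4). splits; auto.
      rewrite Hts; auto. unfold set_ts. rewrite H3. discriminate.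
    + now apply (g_alloc _ _ I).
    + apply (g_glob _ _ I).
    + now apply (g_succ _ _ I).
    + now apply (g_null _ _ I).
    + now apply (g_bits _ _ I).
    + now apply (g_mark _ _ I).
    + apply Hset. now apply (g_frozen _ _ I).
    + now apply (g_past _ _ I).
    + destruct (Nat.eq_dec a0 a) as [-> | Hne].
      * rewrite Hta. cbn. auto.
      * unfold set_ts in *. rewrite (Hx _ Hne) in *. now apply (g_born _ _ I).
    + destruct (g_prior _ _ I a0) as [H1|(?&?&?)]; auto.
      * left. rewrite Hts; auto. unfold set_ts. rewrite H1. discriminate.
      * right. rewrite Hp. auto.
    + eapply ext_chain; eauto. now apply (g_chain _ _ I).
    + now apply (g_dead _ _ I).
    + apply (l_head _ _ I).
    + now apply (l_succ _ _ I).
    + now apply (l_uniq _ _ I).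
    + now apply (l_dead _ _ I).
    + now apply (l_flag _ _ I).
    + now apply (l_mark _ _ I).
  - left. right. unfold marked_live, unfrozen_pub, unset_pub. split.
    { apply count_ext. intros. now rewrite Hn. }
    right. split.
    { apply count_ext. intros. now rewrite Hn. }
    apply count_lt with a; auto.
    + intros x _. rewrite !Nat.eqb_eq. intros H.
      destruct (Nat.eq_dec x a) as [-> | Hne]; auto. now rewrite <- (Hx x Hne).
    + now apply Nat.eqb_neq.
    + now apply Nat.eqb_eq.
Qed.

(** * Changing a [next] pointer: freezing and linking *)

Lemma cas_next_true m a e p m' : cas_next m a e p = (m', true) ->
  next (heap m a) = e /\ m' = set_node m a (with_next (heap m a) p).
Proof.
  unfold cas_next. destruct (ptr_eqb (next (heap m a)) e) eqn:He; intros [= <-].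
  now apply ptr_eqb_eq in He.
Qed.

Lemma cas_next_false m a e p m' : cas_next m a e p = (m', false) ->
  next (heap m a) <> e /\ m' = m.
Proof.
  unfold cas_next. destruct (ptr_eqb (next (heap m a)) e) eqn:He; intros [= <-].
  split; auto. rewrite <- ptr_eqb_eq. congruence.
Qed.

Lemma set_next_fields m a p :
  let m' := set_node m a (with_next (heap m a) p) in
  (forall x, key (heap m' x) = key (heap m x)) /\
  (forall x, ts (heap m' x) = ts (heap m x)) /\
  (forall x, prior (heap m' x) = prior (heap m x)) /\
  next (heap m' a) = p /\ (forall x, x <> a -> heap m' x = heap m x).
Proof.
  intros m'. cbn. splits; try intros x; try destruct (Nat.eqb_spec x a) as [-> |];
    cbn; try reflexivity; try congruence.
  now rewrite Nat.eqb_refl.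
Qed.

Lemma mpath_last G m a l c : mpath G m a l c ->
  l = [] /\ a = c \/ exists b l', l = b :: l' /\ succ_of m b = c /\
  pmark (next (heap m b)) = true /\ mpath G m a l' b.
Proof. intros []; [now left | right; eauto 8]. Qed.

(** Marking and flagging share one proof, [mk] choosing the bit. The two conditional hypotheses are
    what [g_mark] and [l_flag] demand of the newly frozen node. No decrease is claimed for a
    marking, since it adds a live marked node. *)
Lemma ginv_freeze G m a mk o : ginv G m -> In a (pub G) -> set_ts m a ->
  a <> HEAD -> ~ frozen m a -> (mk = true -> succ_of m a <> NULL) ->
  (mk = false -> forall b, live G b -> succ_of m b = a -> pmark (next (heap m b)) = true) ->
  let m' := set_node m a (with_next (heap m a) (mkPtr (succ_of m a) mk (negb mk))) in
  ginv G m' /\ ext G m G m' o /\ frozen m' a /\ (mk = false -> measure_decr G m G m').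
Proof.
  intros I Ha Hts Hah Hu Hmk Hfl.
  set (p := mkPtr (succ_of m a) mk (negb mk)). set (m' := set_node _ _ _). cbv zeta.
  destruct (set_next_fields m a p) as (Hk & Ht & Hp & Hna & Hx).
  fold m' in Hk, Ht, Hp, Hna, Hx.
  assert (Hs : forall x, succ_of m' x = succ_of m x).
  { intros x. destruct (Nat.eq_dec x a) as [-> | Hne]; unfold succ_of;
      [now rewrite Hna | now rewrite Hx]. }
  assert (Hfa : frozen m' a) by (unfold frozen; rewrite Hna; destruct mk; reflexivity).
  assert (Hf : forall x, frozen m' x -> frozen m x \/ x = a).
  { intros x H. destruct (Nat.eq_dec x a) as [-> | Hne]; auto.
    unfold frozen in *. rewrite Hx in H; auto. }
  assert (Hu' : marked_or_flagged (next (heap m a)) = false)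
    by (apply not_true_is_false; auto).
  apply unfrozen_bits in Hu' as Hbits. destruct Hbits as [Hb1 Hb2].
  assert (Hlive : live G a) by (split; auto; now apply (l_dead _ _ I)).
  assert (E : ext G m G m' o).
  { constructor; intros; auto.
    - rewrite Hx; auto. intros ->. contradiction.
    - split; auto. apply Hx. congruence. }
  splits; auto.
  - constructor; intros; rewrite ?Hk, ?Hs, ?Ht, ?Hp in *.
    + destruct (g_head _ _ I) as (H1 & H2 & H3 & H4). splits; auto.
      intros H. destruct (Hf _ H) as [|<-]; auto.
    + now apply (g_alloc _ _ I).
    + apply (g_glob _ _ I).
    + now apply (g_succ _ _ I).
    + now apply (g_null _ _ I).
    + destruct (Nat.eq_dec a0 a) as [-> | Hne].
      * rewrite Hna in *. cbn in *. now subst.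
      * rewrite Hx in * by auto. now apply (g_bits _ _ I).
    + destruct (Nat.eq_dec a0 a) as [-> | Hne].
      * rewrite Hna in *. cbn in *. auto.
      * rewrite Hx in * by auto. now apply (g_mark _ _ I).
    + unfold set_ts. rewrite Ht. destruct (Hf _ H0) as [|<-]; auto.
      now apply (g_frozen _ _ I).
    + now apply (g_past _ _ I).
    + unfold set_ts in *. rewrite ?Ht in *. now apply (g_born _ _ I).
    + unfold set_ts. rewrite Ht. now apply (g_prior _ _ I).
    + eapply ext_chain; eauto. now apply (g_chain _ _ I).
    + now apply (g_dead _ _ I).
    + apply (l_head _ _ I).
    + now apply (l_succ _ _ I).
    + now apply (l_uniq _ _ I).
    + destruct (Nat.eq_dec a0 a) as [-> | Hne]; [contradiction|].
      unfold frozen in *. rewrite Hx in * by auto. now apply (l_dead _ _ I).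
    (* For [l_flag] only a predecessor of the newly flagged node is critical, and [Hfl] says that it
       is marked. *)
    + destruct (Nat.eq_dec (succ_of m a0) a) as [He | Hne].
      * rewrite He, Hna in H1. cbn in H1. destruct mk; [discriminate|].
        rewrite Hx by (intros ->; apply (klt_irrefl (key (heap m a)));
          rewrite <- He at 2; now apply (g_succ _ _ I)).
        now apply Hfl.
      * rewrite (Hx _ Hne) in H1.
        assert (Hm : pmark (next (heap m a0)) = true) by now apply (l_flag _ _ I).
        rewrite Hx; auto. intros ->. congruence.
    + destruct (Nat.eq_dec a0 a) as [-> | Hne]; [apply Hlive|].
      rewrite Hx in * by auto. now apply (l_mark _ _ I).
  - intros ->. right. unfold marked_live, unfrozen_pub. split; [|left].
    + apply count_ext. intros x _. f_equal.
      destruct (Nat.eq_dec x a) as [-> | Hne]; [now rewrite Hna, Hb1 | now rewrite Hx].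
    + apply count_lt with a; auto.
      * intros x _. destruct (Nat.eq_dec x a) as [-> | Hne]; [now rewrite Hu'|].
        now rewrite Hx.
      * now rewrite Hna.
      * now rewrite Hu'.
Qed.

(* Linking the private node [n] between [pred] and [sc], which unlinks the
   segment [seg]; [seg] is empty for an insertion. *)
Definition publish (G : ghost) (m : mem) (n : nat) (seg : list nat) : ghost :=
  mkGhost (n :: pub G) (seg ++ dead G)
    (fun x => if Nat.eqb x n then globalTS m else born G x).

(** Insertion and trimming differ only in what [seg] and [sc] are. Apart from [pred], no live node
    outside [seg] may point into [seg] or at [sc]: this keeps live successors live and predecessors
    unique. Closure of [seg] under marked links preserves [l_mark]. The new node is unmarked, so
    unlinking one live marked node lowers [marked_live]. *)
Lemma publish_ok G m pred old n k sc seg : ginv G m ->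
  In pred (pub G) -> next (heap m pred) = plain old -> In old (pub G) -> set_ts m old ->
  private G m n k sc old -> klt (key (heap m pred)) k ->
  (sc = NULL <-> k = KPosInf) ->
  (sc <> NULL -> live G sc /\ ~ In sc seg /\ klt k (key (heap m sc)) /\ set_ts m sc /\
     pflag (next (heap m sc)) = false) ->
  (forall x, In x seg -> In x (pub G) /\ frozen m x) ->
  (forall x, In x seg -> pmark (next (heap m x)) = true -> In (succ_of m x) seg) ->
  (forall x, live G x -> ~ In x seg -> x <> pred -> succ_of m x <> NULL ->
     ~ In (succ_of m x) seg /\ succ_of m x <> sc) ->
  let m' := set_node m pred (with_next (heap m pred) (plain n)) in
  let G' := publish G m n seg in
  ginv G' m' /\ ext G m G' m' (Some n) /\
  ((exists x, In x seg /\ live G x /\ pmark (next (heap m x)) = true) ->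
     measure_decr G m G' m').
Proof.
  intros I Hpred Hnp Hold Hots (Hn1 & Hn2 & Hn3 & Hn4 & Hnts & Hnk & Hnn & Hnp') Hk
    Hscn Hsc Hseg Hsegm Hsegc m' G'.
  destruct (set_next_fields m pred (plain n)) as (Fk & Ft & Fp & Fn & Fx).
  fold m' in Fk, Ft, Fp, Fn, Fx.
  assert (Fg : globalTS m' = globalTS m) by reflexivity.
  assert (Ff : nextFree m' = nextFree m) by reflexivity.
  clearbody m'.
  assert (Hon : old <> NULL) by now apply (g_alloc _ _ I).
  assert (Hsp : succ_of m pred = old) by (unfold succ_of; now rewrite Hnp).
  assert (Hne : n <> pred) by congruence.
  assert (Hpu : ~ frozen m pred) by (unfold frozen; rewrite Hnp; discriminate).
  assert (Hps : ~ In pred seg) by (intros H; now apply Hseg in H).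
  assert (Sp : succ_of m' pred = n) by (unfold succ_of; now rewrite Fn).
  assert (Sn : succ_of m' n = sc) by (unfold succ_of; now rewrite (Fx n Hne), Hnn).
  assert (Sx : forall x, x <> pred -> succ_of m' x = succ_of m x)
    by (intros; unfold succ_of; now rewrite Fx).
  assert (Hpn : forall x, In x (pub G) -> x <> n) by congruence.
  assert (Hsn : forall x, In x (pub G) -> succ_of m x <> n).
  { intros x H He. apply Hn1. rewrite <- He. apply (g_succ _ _ I); auto. congruence. }
  assert (Hbn : born G' n = globalTS m) by (cbn; now rewrite Nat.eqb_refl).
  assert (Hbx : forall x, In x (pub G) -> born G' x = born G x).
  { intros x H. cbn. destruct (Nat.eqb_spec x n); subst; [contradiction | auto]. }
  assert (Hfz : forall x, frozen m' x <-> frozen m x).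
  { intros x. destruct (Nat.eq_dec x pred) as [-> | H]; unfold frozen;
      [rewrite Fn, Hnp; reflexivity | now rewrite Fx]. }
  assert (Hnf : ~ frozen m n) by (unfold frozen; rewrite Hnn; discriminate).
  assert (Hnd : ~ In n (seg ++ dead G)).
  { intros [H | H] % in_app_or; [apply Hseg in H; tauto | apply (g_dead _ _ I) in H; tauto]. }
  assert (Hlive : forall x, live G' x <-> x = n \/ live G x /\ ~ In x seg).
  { intros x. unfold live. cbn. rewrite in_app_iff. split.
    - intros [[-> | H1] H2]; tauto.
    - intros [-> | H]; [rewrite in_app_iff in Hnd|]; tauto. }
  assert (Hlp : live G pred) by (split; auto; now apply (l_dead _ _ I)).
  assert (E : ext G m G' m' (Some n)).
  { constructor; auto; try lia.
    - intros a H. now right.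
    - intros a H Hf. rewrite Fx; auto. intros ->. contradiction.
    - intros a H1 H2 H3. assert (a <> n) by congruence. split; [intros []; congruence|].
      apply Fx. congruence. }
  assert (Hmk : forall x, In x (pub G) -> pmark (next (heap m' x)) = pmark (next (heap m x))).
  { intros x _. destruct (Nat.eq_dec x pred) as [-> | H]; [now rewrite Fn, Hnp | now rewrite Fx]. }
  assert (Hmn : pmark (next (heap m' n)) = false) by (now rewrite (Fx n Hne), Hnn).
  splits; auto.
  - constructor.
    + destruct (g_head _ _ I) as (H1 & H2 & H3 & H4). rewrite Fk, Ft, Hfz. splits; auto.
      now right.
    + rewrite Ff. intros a [<- | H]; auto. now apply (g_alloc _ _ I).
    + rewrite Fg. apply (g_glob _ _ I).
    + intros a [<- | H].
      * rewrite Sn, !Fk, Hnk. intros H. destruct (Hsc H) as ((? & ?) & _ & ? & _).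
        split; [now right | auto].
      * rewrite !Fk. destruct (Nat.eq_dec a pred) as [-> | Ha].
        -- rewrite Sp, Hnk. split; [now left | auto].
        -- rewrite (Sx a Ha). intros H0. destruct (g_succ _ _ I a); auto.
           split; [now right | auto].
    + intros a [<- | H].
      * now rewrite Sn, Fk, Hnk.
      * rewrite Fk. destruct (Nat.eq_dec a pred) as [-> | Ha].
        -- rewrite Sp. rewrite <- (g_null _ _ I) by auto. rewrite Hsp. tauto.
        -- rewrite (Sx a Ha). now apply (g_null _ _ I).
    + intros a [<- | H]; [congruence|]. rewrite Hmk by auto.
      destruct (Nat.eq_dec a pred) as [-> | Ha]; [now rewrite Hnp|].
      rewrite Fx by auto. now apply (g_bits _ _ I).
    + intros a [<- | H]; [congruence|]. rewrite Hmk by auto.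
      destruct (Nat.eq_dec a pred) as [-> | Ha]; [now rewrite Hnp|].
      rewrite Sx by auto. now apply (g_mark _ _ I).
    + intros a [<- | H]; rewrite Hfz; [tauto|]. unfold set_ts. rewrite Ft.
      now apply (g_frozen _ _ I).
    + rewrite Fg. intros a [<- | H]; [now rewrite Hbn|].
      rewrite Hbx by auto. now apply (g_past _ _ I).
    + intros a [<- | H]; unfold set_ts; rewrite Ft; [tauto|].
      rewrite Hbx, Fg by auto. now apply (g_born _ _ I).
    + intros a [<- | H]; unfold set_ts; rewrite Fp, !Ft.
      * right. rewrite Hnp'. cbn. auto.
      * destruct (g_prior _ _ I a) as [|(?&?&?)]; auto. right. cbn. auto.
    + intros a [<- | H].
      * rewrite Sn. intros H. destruct (Hsc H) as ((? & ?) & _ & ? & ? & _).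
        (* The new node is born now and [sc] is already stamped, so the chain ends at once. *)
        apply chain_base; [now right | now rewrite !Fk, Hnk | |].
        -- unfold set_ts. now rewrite Ft.
        -- rewrite Ft, Hbn. now apply (g_born _ _ I).
      * destruct (Nat.eq_dec a pred) as [-> | Ha].
        (* Behind the new successor of [pred] lies its [prior], the former successor, whose chain is
           known. *)
        -- intros _. rewrite Sp. apply chain_step; [now left | now rewrite !Fk, Hnk|].
           rewrite Fp, Hnp'. eapply ext_chain; eauto.
           rewrite <- Hsp. apply (g_chain _ _ I); congruence.
        -- rewrite Sx by auto. intros H0. eapply ext_chain; eauto. now apply (g_chain _ _ I).
    + intros a. cbn. rewrite in_app_iff. intros [H | H]; right; [now apply Hseg|].
      now apply (g_dead _ _ I).
    + cbn. rewrite in_app_iff. intros [H | H]; [|now apply (l_head _ _ I)].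
      apply Hseg in H. now apply (g_head _ _ I).
    + intros a Ha. rewrite !Hlive. apply Hlive in Ha as [-> | [Ha Has]].
      * rewrite Sn. intros H. right. split; now apply Hsc.
      * destruct (Nat.eq_dec a pred) as [-> | Hap]; [now left|].
        rewrite Sx by auto. intros H. right.
        split; [now apply (l_succ _ _ I) | now apply Hsegc].
    + intros a b Ha Hb. apply Hlive in Ha as [-> | [Ha Has]]; apply Hlive in Hb as [-> | [Hb Hbs]]; auto.
      * rewrite Sn. destruct (Nat.eq_dec b pred) as [-> | Hbp].
        -- rewrite Sp. intros -> Hnul. exfalso. now apply Hn1, (proj1 (Hsc Hnul)).
        -- rewrite Sx by auto. intros He Hnul. exfalso.
           now apply (Hsegc b); auto; congruence.
      * rewrite Sn. destruct (Nat.eq_dec a pred) as [-> | Hbp].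
        -- rewrite Sp. intros <- Hnul. exfalso. now apply Hn1, (proj1 (Hsc Hnul)).
        -- rewrite Sx by auto. intros He Hnul. exfalso.
           now apply (Hsegc a); auto; congruence.
      * destruct (Nat.eq_dec a pred) as [-> | Hap]; destruct (Nat.eq_dec b pred) as [-> | Hbp];
          auto; rewrite ?Sp, ?Sx by auto; intros He.
        -- symmetry in He. now apply Hsn in He; [|apply Hb].
        -- now apply Hsn in He; [|apply Ha].
        -- now apply (l_uniq _ _ I).
    + intros a Ha. rewrite Hfz. destruct Ha as [<- | Ha]; auto. intros Hf.
      cbn. rewrite in_app_iff. intros [H | H]; [now apply Hseg in H | now apply (l_dead _ _ I a)].
    + intros a Ha. apply Hlive in Ha as [-> | [Ha Has]].
      * rewrite Sn. intros H. destruct (Nat.eq_dec sc pred) as [-> | Hsp'].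
        -- rewrite Fn. discriminate.
        -- rewrite Fx by auto. destruct (Hsc H) as (_ & _ & _ & _ & ->). discriminate.
      * rewrite Hmk by apply Ha. destruct (Nat.eq_dec a pred) as [-> | Hap].
        -- rewrite Sp, Fx, Hnn by auto. discriminate.
        -- rewrite Sx by auto. intros H.
           destruct (Nat.eq_dec (succ_of m a) pred) as [-> | Hsp'];
             [rewrite Fn; discriminate|].
           rewrite Fx by auto. now apply (l_flag _ _ I).
    + intros a [<- | Ha]; [congruence|]. rewrite Hmk by auto. intros Hm.
      assert (Hap : a <> pred) by (intros ->; rewrite Hnp in Hm; discriminate).
      rewrite Sx by auto. intros Hl. apply Hlive in Hl as [Hl | [Hl Hls]].
      { now apply Hsn in Hl. }
      cbn. rewrite in_app_iff. intros [H | H]; [now apply Hls, Hsegm|].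
      now apply (l_mark _ _ I a).
  - intros (x & Hx & Hxl & Hxm). left. unfold marked_live, count. cbn [pub G' publish filter].
    rewrite Hmn, andb_false_r. apply count_lt with x.
    + intros y Hy. rewrite Hmk by auto. intros H. apply andb_true_iff in H as [H ->].
      rewrite andb_true_r. unfold deadb in *.
      destruct (in_dec Nat.eq_dec y (dead G)) as [Hd | Hd]; auto.
      destruct (in_dec Nat.eq_dec y (dead G')) as [Hd' | Hd']; auto.
      exfalso. apply Hd'. cbn. apply in_app_iff. auto.
    + apply Hxl.
    + unfold deadb. destruct (in_dec Nat.eq_dec x (dead G')) as [Hd' | Hd']; auto.
      exfalso. apply Hd'. cbn. apply in_app_iff. auto.
    + unfold deadb. destruct (in_dec Nat.eq_dec x (dead G)) as [Hd | Hd]; auto.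
      now apply Hxl in Hd.
Qed.

(** * Insertion, trimming, flagging and marking preserve the invariant *)

Lemma live_unfrozen G m a : ginv G m -> In a (pub G) -> ~ frozen m a -> live G a.
Proof. intros I H1 H2. split; auto. now apply (l_dead _ _ I). Qed.

Lemma succ_ne_HEAD G m a : ginv G m -> In a (pub G) -> succ_of m a <> HEAD.
Proof.
  intros I H He. destruct (g_succ _ _ I a) as [_ H2]; auto.
  { rewrite He. discriminate. }
  rewrite He in H2. destruct (g_head _ _ I) as (_ & H3 & _). rewrite H3 in H2.
  unfold klt in H2. destruct (key (heap m a)); discriminate.
Qed.

Lemma ginv_insert G m pred curr n k m' : ginv G m -> inserting G m k pred curr ->
  private G m n (KFin k) curr curr -> next (heap m pred) = plain curr ->
  m' = set_node m pred (with_next (heap m pred) (plain n)) ->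
  exists G', ginv G' m' /\ ext G m G' m' (Some n) /\ In n (pub G').
Proof.
  intros I (H1 & H2 & H3 & H4 & H5) Hp Hn ->.
  assert (Hpl : live G pred).
  { apply (live_unfrozen G m); auto. unfold frozen. rewrite Hn. discriminate. }
  assert (Hs : succ_of m pred = curr) by (unfold succ_of; now rewrite Hn).
  assert (Hcn : curr <> NULL) by now apply (g_alloc _ _ I).
  destruct (publish_ok G m pred curr n (KFin k) curr [] I) as (A & B & _); auto.
  - split; [intros ?; contradiction | discriminate].
  - intros _. splits; auto.
    + rewrite <- Hs. apply (l_succ _ _ I); congruence.
    (* [pred] is live and unmarked, so by [l_flag] its successor cannot be flagged. *)
    + apply not_true_is_false. intros Hf. rewrite <- Hs in Hf.
      apply (l_flag _ _ I) in Hf; auto; [|congruence].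
      rewrite Hn in Hf. discriminate.
  - intros x [].
  - intros x Hx _ Hxp Hxn. split; auto. intros He. apply Hxp.
    apply (l_uniq _ _ I); auto. congruence.
  - exists (publish G m n []). splits; auto. now left.
Qed.

(** Together with uniqueness of live predecessors, the second clause shows that a live path can be
    entered from outside only at its start. The third lets the liveness of a victim, known from a
    successful CAS, spread over the whole segment. *)
Lemma mpath_spec G m a l c : ginv G m -> mpath G m a l c ->
  (forall x, In x l -> pmark (next (heap m x)) = true /\ In (succ_of m x) (c :: l) /\
     klt (key (heap m x)) (key (heap m c))) /\
  (forall y, In y (c :: l) -> y = a \/ exists u, In u l /\ succ_of m u = y) /\
  (live G a -> forall x, In x (c :: l) -> live G x) /\
  (a = c \/ klt (key (heap m a)) (key (heap m c))) /\
  In a (c :: l).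
Proof.
  intros I H. induction H as [Ha | l b H IH Hb].
  - splits; try (now left).
    + intros x [].
    + intros y [<- | []]; auto.
    + intros Hl x [<- | []]; auto.
  - destruct IH as (I1 & I2 & I3 & I4 & I5).
    destruct (mpath_pub _ _ _ _ _ I H) as [Hp _].
    assert (Hn : succ_of m b <> NULL) by now apply (g_mark _ _ I).
    destruct (g_succ _ _ I b Hp Hn) as [Hsp Hsk].
    splits.
    + intros x [<- | Hx]; [splits; auto; now left|].
      destruct (I1 x Hx) as (J1 & J2 & J3).
      splits; auto; [now right | eapply klt_trans; eauto].
    + intros y [<- | [<- | Hy]].
      * right. exists b. split; auto. now left.
      * destruct (I2 b) as [|(u & ? & ?)]; [now left | auto | right; exists u; split; auto; now right].
      * destruct (I2 y) as [|(u & ? & ?)]; [now right | auto | right; exists u; split; auto; now right].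
    + intros Hl x [<- | Hx].
      * apply (l_succ _ _ I); auto. apply I3; auto. now left.
      * apply I3; auto.
    + right. destruct I4 as [-> | I4]; auto. eapply klt_trans; eauto.
    + now right.
Qed.

Lemma ginv_trim G m fk fc pred victim curr sc nc m' : ginv G m ->
  trimming G m fk fc pred victim curr -> flagged_succ m curr sc ->
  (sc <> NULL -> set_ts m sc) -> private G m nc (key (heap m curr)) sc victim ->
  next (heap m pred) = plain victim ->
  m' = set_node m pred (with_next (heap m pred) (plain nc)) ->
  exists G', ginv G' m' /\ ext G m G' m' (Some nc) /\ In nc (pub G') /\
    measure_decr G m G' m'.
Proof.
  intros I (Has & Hv & Hvf & Hc & l & Hl) [Hf Hsc] Hscts Hp Hn ->.
  destruct Has as (_ & [Hpp _] & _).
  destruct (mpath_spec _ _ _ _ _ I Hl) as (J1 & J2 & J3 & J4 & J5).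
  assert (Hpu : ~ frozen m pred) by (unfold frozen; rewrite Hn; discriminate).
  assert (Hpl : live G pred) by now apply (live_unfrozen G m).
  assert (Hs : succ_of m pred = victim) by (unfold succ_of; now rewrite Hn).
  assert (Hvn : victim <> NULL) by now apply (g_alloc _ _ I).
  assert (Hvl : live G victim) by (rewrite <- Hs; apply (l_succ _ _ I); congruence).
  assert (Hpv : klt (key (heap m pred)) (key (heap m victim)))
    by (rewrite <- Hs; apply (g_succ _ _ I); congruence).
  assert (Hcl : live G curr) by (apply J3; auto; now left).
  assert (Hcm : pmark (next (heap m curr)) = false).
  { apply not_true_is_false. intros H. apply (g_bits _ _ I) in H; auto. congruence. }
  assert (Hseg : forall x, In x (curr :: l) -> In x (pub G) /\ frozen m x).
  { intros x Hx. split; [now apply J3|]. destruct Hx as [<- | Hx].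
    - now apply pflag_frozen.
    - now apply pmark_frozen, J1. }
  (* If [victim] were the flagged [curr], the unmarked live [pred] would precede a flagged node. So
     the segment has a marked node besides its flagged end, and the measure drops. *)
  assert (Hvs : In victim l).
  { destruct J5 as [He |]; auto. exfalso. rewrite He, <- Hs in Hf.
    assert (H : pmark (next (heap m pred)) = true)
      by (apply (l_flag _ _ I); auto; congruence).
    rewrite Hn in H. discriminate. }
  destruct (publish_ok G m pred victim nc (key (heap m curr)) sc (curr :: l) I) as (A & B & C); auto.
  - now apply (g_frozen _ _ I).
  - destruct J4 as [<- | J4]; auto. eapply klt_trans; eauto.
  - rewrite Hsc. now apply (g_null _ _ I).
  - intros Hscn. rewrite Hsc in *. destruct (g_succ _ _ I curr Hc Hscn) as [K1 K2].
    splits; auto.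
    + now apply (l_succ _ _ I).
    + intros [He | Hin].
      * rewrite <- He in K2. now apply klt_irrefl in K2.
      * destruct (J1 _ Hin) as (_ & _ & K3). apply (klt_irrefl (key (heap m curr))).
        eapply klt_trans; eauto.
    + apply not_true_is_false. intros H. apply (l_flag _ _ I) in H; auto. congruence.
  - intros x [<- | Hx] Hm; [congruence|]. now apply J1.
  (* By uniqueness, a live node pointing into the segment is [pred] or an interior node, and one
     pointing at [sc] is [curr]. *)
  - intros x Hx Hxs Hxp Hxn. split.
    + intros Hin. apply J2 in Hin as [He | (u & Hu & He)].
      * apply Hxp. apply (l_uniq _ _ I); auto. congruence.
      * apply Hxs. right. replace x with u; auto.
        apply (l_uniq _ _ I); auto; [|congruence]. apply J3; auto. now right.
    + intros He. apply Hxs. left. apply (l_uniq _ _ I); auto; congruence.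
  - exists (publish G m nc (curr :: l)). splits; auto; try (now left).
    apply C. exists victim. splits; [now right | auto | now apply J1].
Qed.

Lemma ginv_flag G m fk fc pred victim curr p m' o : ginv G m ->
  trimming G m fk fc pred victim curr -> set_ts m curr -> marked_or_flagged p = false ->
  next (heap m curr) = p ->
  m' = set_node m curr (with_next (heap m curr) (mkPtr (pref p) (pmark p) true)) ->
  ginv G m' /\ ext G m G m' o /\ pflag (next (heap m' curr)) = true /\ measure_decr G m G m'.
Proof.
  intros I (_ & Hv & Hvf & Hc & l & Hl) Hts Hp Hn ->.
  apply unfrozen_bits in Hp as Hb. destruct Hb as [-> _]. rewrite <- Hn.
  assert (Hcu : ~ frozen m curr) by (unfold frozen; congruence).
  assert (Hcl : live G curr) by now apply (live_unfrozen G m).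
  destruct (mpath_last _ _ _ _ _ Hl) as [[_ He] | (b & l' & -> & Hb & Hbm & Hl')];
    [now subst|].
  destruct (mpath_pub _ _ _ _ _ I Hl') as [Hbp _].
  assert (Hcn : curr <> NULL) by now apply (g_alloc _ _ I).
  destruct (ginv_freeze G m curr false o I) as (A & B & C & D); auto.
  - rewrite <- Hb. now apply (succ_ne_HEAD G m).
  - discriminate.
  - intros _ b' Hb' He. replace b' with b; auto.
    apply (l_uniq _ _ I); try congruence.
    split; auto. apply (l_mark _ _ I); auto. congruence.
  - splits; auto. cbn. now rewrite Nat.eqb_refl.
Qed.

(** A removed node has a finite key, so it is neither the head nor a node with successor [NULL]. *)
Lemma ginv_mark G m k curr p m' o : ginv G m ->
  removing G m k curr -> marked_or_flagged p = false -> next (heap m curr) = p ->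
  m' = set_node m curr (with_next (heap m curr) (mkPtr (pref p) true (pflag p))) ->
  ginv G m' /\ ext G m G m' o.
Proof.
  intros I (Hc & Hts & Hk) Hp Hn ->.
  apply unfrozen_bits in Hp as Hb. destruct Hb as [_ ->]. rewrite <- Hn.
  destruct (ginv_freeze G m curr true o I) as (A & B & _); auto.
  - intros ->. destruct (g_head _ _ I) as (_ & H & _). congruence.
  - unfold frozen. congruence.
  - intros _ H. apply (g_null _ _ I) in H; auto. congruence.
  - discriminate.
Qed.

(** * Steps of a single thread *)

(** After its marking ([KRem2]) a removal has nothing left to pay for, nor has a range query after
    its clock increment. *)
Definition fc_weight (fc : fcont) : nat :=
  match fc with KIns _ _ | KRem1 _ => 1 | _ => 0 end.

(* Bounds the insertions, markings and clock increments still to be made before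
   the current operation completes. *)
Definition weight (s : pc) : nat :=
  match s with
  | F_Retry _ fc | F_While _ fc _ _ _ | F_NullTest _ fc _ _ _ | F_Step _ fc _ _ _
  | F_KeyTest _ fc _ _ _ | F_Adv _ fc _ | F_PredTs1 _ fc _ _ _ | F_PredTs2 _ fc _ _ _ _
  | F_AfterTrim _ fc _ | F_Check _ fc _ _ | F_CurrTs1 _ fc _ _ | F_CurrTs2 _ fc _ _ _
  | T_While _ fc _ _ _ | T_Step _ fc _ _ _ | T_Ts1 _ fc _ _ _ | T_Ts2 _ fc _ _ _ _
  | T_Flag1 _ fc _ _ _ | T_Flag2 _ fc _ _ _ _ | T_FlagFail _ fc _ _ _ | T_Succ _ fc _ _ _
  | T_SuccTs1 _ fc _ _ _ _ | T_SuccTs2 _ fc _ _ _ _ _ | T_Alloc _ fc _ _ _ _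
  | T_Cas _ fc _ _ _ | T_NewTs1 _ fc _ _ | T_NewTs2 _ fc _ _ _ => fc_weight fc
  | I_Alloc _ _ _ _ | I_Cas _ _ _ _ _ | R_Mark1 _ _ | R_Mark2 _ _ _ | Q_Start _ _ => 1
  | _ => 0
  end.

(** A private node is owned only from its allocation to the next step of its thread, so a newly
    owned node is the one just allocated; this keeps the private nodes of different threads
    distinct. *)
Definition step_ok (G : ghost) (m : mem) (s : pc) (m' : mem) (r : pc + resp) : Prop :=
  exists G', ginv G' m' /\ ext G m G' m' (own s) /\
  match r with
  | inl s' => tinv G' m' s' /\ (forall a, own s' = Some a -> a = nextFree m) /\
      (weight s' < weight s \/
       weight s' = weight s /\ (measure_decr G m G' m' \/ quiet G m G' m'))
  | inr _ => True
  end.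

Lemma step_read G m s s' : ginv G m -> own s' = None -> weight s' = weight s ->
  tinv G m s' -> step_ok G m s m (inl s').
Proof.
  intros I Ho Hw Ht. exists G. splits; auto using ext_refl, quiet_refl. congruence.
Qed.

Lemma step_ts G m s a t m' b s' : ginv G m -> pend G m a t -> cas_ts m a t = (m', b) ->
  own s' = None -> weight s' = weight s ->
  (ext G m G m' (own s) -> set_ts m' a -> tinv G m' s') -> step_ok G m s m' (inl s').
Proof.
  intros I Hp Hc Ho Hw Ht.
  destruct (ginv_cas_ts G m a t m' b (own s) I Hp Hc) as (H1 & H2 & H3 & H4).
  exists G. splits; auto. congruence.
Qed.

Lemma pend_now G m a : ginv G m -> In a (pub G) -> pend G m a (globalTS m).
Proof.
  intros I H. unfold pend. splits; auto; try apply I; auto.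
Qed.

Lemma succ_pub G m a : ginv G m -> In a (pub G) -> key (heap m a) <> KPosInf ->
  In (succ_of m a) (pub G).
Proof.
  intros I H Hk. apply (g_succ _ _ I); auto. now rewrite (g_null _ _ I).
Qed.

Lemma pred_ok_succ G m fk a : ginv G m -> pred_ok G m fk a -> In (succ_of m a) (pub G).
Proof.
  intros I [H1 H2]. apply succ_pub; auto. destruct H2 as [H2 | ->].
  - now apply klt_neq_PosInf in H2.
  - destruct (g_head _ _ I) as (_ & -> & _). discriminate.
Qed.

Lemma find_ret_ok G m fk fc pred curr : ginv G m -> found G m fk fc pred curr ->
  set_ts m curr ->
  match find_ret m fc pred curr with
  | inl s' => tinv G m s' /\ own s' = None /\ weight s' = fc_weight fc
  | inr _ => True
  end.
Proof.
  intros I ((Hfc & [Hp Hpk] & Hpt) & Hc & Hk) Ht.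
  destruct fc as [k v | k | c0 | k | low high t]; cbn in *; unfold rd in *.
  - subst fk. destruct (ekey_eqb _ _) eqn:He; auto. cbn. splits; auto.
    unfold inserting. splits; auto.
    + destruct Hpk as [| ->]; auto. destruct (g_head _ _ I) as (_ & -> & _). reflexivity.
    + now apply ekey_eqb_false_klt.
  - subst fk. destruct (ekey_eqb _ _) eqn:He; auto. cbn. splits; auto.
    unfold removing. splits; auto. now apply ekey_eqb_eq.
  - auto.
  - destruct (ekey_eqb _ _); auto.
  - unfold visited. intuition.
Qed.

Ltac read_step := apply step_read; auto; cbn.

Local Arguments Nat.ltb : simpl never.

Lemma exec_step G m s m' r : ginv G m -> tinv G m s -> exec m s = (m', r) ->
  step_ok G m s m' r.
Proof.
  intros I H He. destruct s; cbn in H, He; unfold rd in He.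
  - injection He as <- <-. read_step.
    destruct (g_head _ _ I) as (H1 & H2 & H3 & H4).
    assert (Hs : In (succ_of m HEAD) (pub G)) by (apply succ_pub; auto; now rewrite H2).
    unfold scan, pred_ok. splits; auto. now apply not_true_is_false.
  - injection He as <- <-.
    destruct (marked_or_flagged _) eqn:Hf; read_step; auto.
  - injection He as <- <-. destruct H as [H Hf].
    destruct (Nat.eqb_spec (pref (next (heap m curr))) NULL); read_step; auto.
  - injection He as <- <-. destruct H as [(H1 & H2 & H3 & H4 & H5 & H6) [Hf Hn]].
    read_step. unfold scan. splits; auto.
    + now apply (g_succ _ _ I).
    + right. destruct H6; congruence.
  - injection He as <- <-.
    destruct (ekey_le _ _) eqn:Hk; read_step; auto.
    destruct H as (H1 & H2 & H3 & H4 & H5 & H6).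
    splits; auto. now apply ekey_le_false.
  - injection He as <- <-. destruct H as (H1 & H2 & H3).
    destruct (marked_or_flagged _) eqn:Hf; read_step; auto.
    assert (pred_ok G m fk pred) by (split; auto).
    pose proof (pred_ok_succ G m fk pred I H).
    unfold scan. splits; auto.
  - injection He as <- <-. read_step. destruct H as [H1 H2].
    splits; auto. apply pend_now; auto. apply H1.
  - destruct (cas_ts m pred t) as [m1 b] eqn:Hc. injection He as <- <-.
    destruct H as (H1 & H2 & H3).
    eapply step_ts; eauto.
    + destruct (ptr_eqb _ _); reflexivity.
    + destruct (ptr_eqb _ _); reflexivity.
    + intros E Hts. eapply ext_scan in H1 as H1'; eauto.
      destruct H1' as (J1 & J2 & J3 & J4 & J5 & J6).
      destruct (ptr_eqb predNext (plain curr)) eqn:Hq; cbn.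
      * unfold found, after_scan. splits; auto.
        rewrite (e_key _ _ _ _ _ E) by apply H1; auto.
      * unfold trimming, after_scan. splits; auto.
        (* If [curr] were still the node that [predNext] refers to, the comparison with [plain curr]
           would have succeeded. *)
        -- destruct J6 as [-> |]; auto. exfalso.
           rewrite (unfrozen_plain _ J3) in Hq. cbn in Hq.
           assert (ptr_eqb (plain (pref predNext)) (plain (pref predNext)) = true)
             by now apply ptr_eqb_eq.
           congruence.
        -- exists []. now apply mp_nil.
  - injection He as <- <-. pose proof H as (H1 & H2 & H3).
    destruct (marked_or_flagged _) eqn:Hf; read_step; auto.
    split; auto. eapply pred_ok_succ; eauto.
  - injection He as <- <-. destruct H as [H Hc]. pose proof H as (H1 & H2 & H3).
    destruct (marked_or_flagged _ || _) eqn:Hf; read_step; auto.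
    unfold found. splits; auto. apply orb_false_iff in Hf as [_ Hf].
    unfold ekey_le. now rewrite Hf.
  - injection He as <- <-. read_step. splits; auto. apply pend_now; auto. apply H.
  - destruct (cas_ts m curr t) as [m1 b] eqn:Hc. injection He as <- <-.
    destruct H as [H1 H2].
    destruct (ginv_cas_ts G m curr t m1 b None I H2 Hc) as (K1 & K2 & K3 & K4).
    eapply (ext_found G m) in H1; eauto.
    pose proof (find_ret_ok G m1 fk fc pred curr K1 H1 K3) as Hr.
    exists G. splits; auto. destruct (find_ret _ _ _ _) as [s'|]; auto.
    destruct Hr as (R1 & R2 & R3). splits; auto. congruence.
  - injection He as <- <-. destruct (pmark _) eqn:Hf; read_step; auto.
  - injection He as <- <-. destruct H as [(H1 & H2 & H3 & H4 & l & H5) Hm].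
    read_step. unfold trimming. splits; auto.
    + apply (g_succ _ _ I); auto. now apply (g_mark _ _ I).
    + exists (curr :: l). now apply mp_snoc.
  - injection He as <- <-. read_step. splits; auto. apply pend_now; auto. apply H.
  - destruct (cas_ts m curr t) as [m1 b] eqn:Hc. injection He as <- <-.
    destruct H as [H1 H2]. eapply step_ts; eauto. cbn. eauto with ext.
  - injection He as <- <-. destruct H as [H1 H2].
    destruct (marked_or_flagged _) eqn:Hf; read_step; auto.
  - destruct (cas_next _ _ _ _) as [m1 []] eqn:Hc; injection He as <- <-;
      destruct H as (H1 & H2 & H3).
    + apply cas_next_true in Hc as [Hn Hc].
      destruct (ginv_flag G m fk fc pred victim curr p m1 None I) as (K1 & K2 & K3 & K4); auto.
      exists G. splits; auto; [|discriminate]. cbn. split; auto.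
      eapply (ext_trimming G m); eauto.
    + apply cas_next_false in Hc as [_ ->]. read_step.
  - injection He as <- <-. destruct (pflag _) eqn:Hf; read_step; auto. apply H.
  - injection He as <- <-. destruct H as [H1 H2].
    destruct (Nat.eqb_spec (pref (next (heap m curr))) NULL) as [Hn | Hn]; read_step;
      splits; auto; try (split; auto). contradiction.
  - injection He as <- <-. destruct H as (H1 & H2 & H3). read_step. splits; auto.
    apply pend_now; auto. destruct H2 as [_ ->]. apply (g_succ _ _ I); auto. apply H1.
  - destruct (cas_ts m succ t) as [m1 b] eqn:Hc. injection He as <- <-.
    destruct H as (H1 & H2 & H3). eapply step_ts; eauto. cbn. intros E Hts.
    splits; eauto with ext. eapply (ext_flagged_succ G m); eauto. apply H1.
  - destruct H as (H1 & H2 & H3).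
    set (n := mkNode BOT (key (heap m curr)) (value (heap m curr)) (plain succ) victim) in *.
    destruct (ginv_alloc G m n None I) as (K1 & K2 & K3).
    injection He as <- <-. change (mkMem _ _ _) with (fst (alloc m n)).
    exists G. splits; auto; [|cbn; congruence].
    pose proof H1 as (_ & Hv & _ & Hcu & _).
    assert (Hv' := g_alloc _ _ I _ Hv). assert (Hcu' := g_alloc _ _ I _ Hcu).
    exists curr, succ. splits.
    + eapply (ext_trimming G m); eauto.
    + eapply (ext_flagged_succ G m); eauto.
    + eapply (ext_succ_ts G m); eauto.
    + rewrite (e_key _ _ _ _ _ K2) by auto. unfold private.
      assert (Hf : heap (fst (alloc m n)) (nextFree m) = n)
        by (cbn; now rewrite Nat.eqb_refl).
      rewrite Hf. cbn. unfold NULL. splits; auto; try lia.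
      intros Hin. apply (g_alloc _ _ I) in Hin. lia.
  - destruct H as (curr & sc & H1 & H2 & H3 & H4).
    destruct (cas_next _ _ _ _) as [m1 []] eqn:Hc; injection He as <- <-.
    + apply cas_next_true in Hc as [Hn Hc].
      destruct (ginv_trim G m fk fc pred victim curr sc newCurr m1 I H1 H2 H3 H4 Hn Hc)
        as (G' & K1 & K2 & K3 & K4).
      exists G'. splits; auto; [|discriminate]. cbn. split; auto.
      destruct H1 as [H1 _]. eapply (ext_after_scan G m); eauto.
    + apply cas_next_false in Hc as [_ ->]. read_step. apply H1.
  - injection He as <- <-. destruct H as [H1 H2]. read_step. splits; auto.
    apply pend_now; auto.
  - destruct (cas_ts m newCurr t) as [m1 b] eqn:Hc. injection He as <- <-.
    destruct H as [H1 H2]. eapply step_ts; eauto. cbn. eauto with ext.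
  - set (n := mkNode BOT (KFin k) v (plain curr) curr) in *.
    destruct (ginv_alloc G m n None I) as (K1 & K2 & K3).
    injection He as <- <-. change (mkMem _ _ _) with (fst (alloc m n)).
    exists G. splits; auto; [|cbn; congruence].
    pose proof H as (_ & Hcu & _). assert (Hcu' := g_alloc _ _ I _ Hcu).
    split; [eapply (ext_inserting G m); eauto|]. unfold private.
    assert (Hf : heap (fst (alloc m n)) (nextFree m) = n)
      by (cbn; now rewrite Nat.eqb_refl).
    rewrite Hf. cbn. unfold NULL. splits; auto; try lia.
    intros Hin. apply (g_alloc _ _ I) in Hin. lia.
  - destruct H as [H1 H2].
    destruct (cas_next _ _ _ _) as [m1 []] eqn:Hc; injection He as <- <-.
    + apply cas_next_true in Hc as [Hn Hc].
      destruct (ginv_insert G m pred curr newNode k m1 I H1 H2 Hn Hc)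
        as (G' & K1 & K2 & K3).
      exists G'. splits; auto; discriminate.
    + apply cas_next_false in Hc as [_ ->]. read_step. reflexivity.
  - injection He as <- <-. read_step. apply pend_now; auto.
  - destruct (cas_ts m newNode t) as [m1 b] eqn:Hc. injection He as <- <-.
    destruct (ginv_cas_ts G m newNode t m1 b None I H Hc) as (K1 & K2 & _).
    exists G. auto.
  - injection He as <- <-. destruct (marked_or_flagged _) eqn:Hf; read_step; auto.
  - destruct H as [H1 H2].
    destruct (cas_next _ _ _ _) as [m1 []] eqn:Hc; injection He as <- <-.
    + apply cas_next_true in Hc as [Hn Hc].
      destruct (ginv_mark G m k curr p m1 None I) as (K1 & K2); auto.
      exists G. splits; auto; cbn; auto; discriminate.
    + apply cas_next_false in Hc as [_ ->]. read_step. reflexivity.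
  - injection He as <- <-. destruct (ginv_fetch G m None I) as [K1 K2].
    pose proof (g_glob _ _ I).
    exists G. splits; auto; cbn; auto; try discriminate. lia.
  - injection He as <- <-. destruct H as [(H1 & H2 & H3) H4].
    destruct (Nat.ltb_spec t (ts (heap m pred))); [|destruct (ekey_le _ _)]; read_step; auto.
    (* A stamp above [t] exceeds 2, so [prior] is a linked node. *)
    + unfold visited. destruct (g_prior _ _ I pred) as [Hp|(?&?&?)]; auto; try lia.
    + unfold at_time, visited. auto.
  - injection He as <- <-. read_step. lia.
  - injection He as <- <-. destruct (ekey_lt _ _) eqn:Hk; read_step; auto.
    split; auto. eapply klt_neq_PosInf; eauto.
  - injection He as <- <-. destruct H as [[(H1 & H2 & H3) H4] H5]. read_step.
    split; auto. now apply succ_pub.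
  - injection He as <- <-. destruct H. read_step. split; auto. now apply pend_now.
  - destruct (cas_ts m succ g) as [m1 b] eqn:Hc. injection He as <- <-.
    destruct H as [H1 H2]. eapply step_ts; eauto. cbn. intros E Hts.
    unfold visited. splits; auto. apply H2.
  - injection He as <- <-. destruct H as (H1 & H2 & H3).
    destruct (Nat.ltb_spec t (ts (heap m succ))); read_step.
    + unfold visited. destruct (g_prior _ _ I succ) as [Hp|(?&?&?)]; auto; try lia.
    + unfold at_time, visited. auto.
  - destruct (ekey_le _ _) eqn:Hk; injection He as <- <-.
    + read_step. split; auto. intros Hp. rewrite Hp in Hk. discriminate.
    + exists G. auto using ext_refl.
  - injection He as <- <-. destruct H as [[(H1 & H2 & H3) H4] H5]. read_step.
    split; auto. now apply succ_pub.
  - injection He as <- <-. destruct H. read_step. split; auto. now apply pend_now.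
  - destruct (cas_ts m succ g) as [m1 b] eqn:Hc. injection He as <- <-.
    destruct H as [H1 H2]. eapply step_ts; eauto. cbn. intros E Hts.
    unfold visited. splits; auto. apply H2.
  - injection He as <- <-. destruct H as (H1 & H2 & H3).
    destruct (Nat.ltb_spec t (ts (heap m succ))); read_step.
    + unfold visited. destruct (g_prior _ _ I succ) as [Hp|(?&?&?)]; auto; try lia.
    + unfold at_time, visited. auto.
Qed.

(** * The system *)

Record sinv (G : ghost) (c : config) : Prop := {
  s_mem : ginv G (cmem c);
  s_thr : forall t s, cthr c t = Busy s -> tinv G (cmem c) s;
  s_own : forall t u s s' a, t <> u -> cthr c t = Busy s -> cthr c u = Busy s' ->
    own s = Some a -> own s' <> Some a
}.

Lemma sinv_init : exists G, sinv G init_config.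
Proof.
  (* Both births get the initial clock value 2, so that the tail, stamped 2, ends the chain of the
     head. *)
  exists (mkGhost [HEAD; TAIL] [] (fun _ => 2)). constructor; try discriminate.
  assert (Hcase : forall a, In a [HEAD; TAIL] -> a = HEAD \/ a = TAIL)
    by (intros a [<- | [<- | []]]; auto).
  constructor; cbn [pub dead born cmem init_config];
    try (intros a Ha; apply Hcase in Ha as [-> | ->]; cbn; unfold set_ts, BOT, NULL; cbn;
         try lia; try tauto; try discriminate; fail).
  - cbn. unfold frozen. cbn. intuition discriminate.
  - intros a Ha; apply Hcase in Ha as [-> | ->]; cbn; unfold HEAD, TAIL, NULL; lia.
  - cbn. lia.
  - intros a Ha; apply Hcase in Ha as [-> | ->]; unfold succ_of; cbn; [|contradiction].
    intros _. split; [now right; left | reflexivity].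
  - intros a Ha; apply Hcase in Ha as [-> | ->]; unfold succ_of; cbn; split; auto; discriminate.
  - intros a Ha; apply Hcase in Ha as [-> | ->]; unfold succ_of; cbn; [|contradiction].
    intros _. apply chain_base; cbn; auto; try reflexivity. discriminate.
  - intros a [].
  - intros [].
  - intros a [Ha _]; apply Hcase in Ha as [-> | ->]; unfold succ_of, live; cbn; [|contradiction].
    auto.
  - intros a b [Ha _] [Hb _].
    apply Hcase in Ha as [-> | ->]; apply Hcase in Hb as [-> | ->]; unfold succ_of; cbn; auto;
      try discriminate; contradiction.
  - intros a [Ha _]; apply Hcase in Ha as [-> | ->]; unfold succ_of; cbn; auto; discriminate.
Qed.

Lemma own_private G m s a : tinv G m s -> own s = Some a ->
  ~ In a (pub G) /\ a < nextFree m.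
Proof.
  intros H Ho. destruct s; try discriminate; cbn in *; injection Ho as ->.
  - destruct H as (? & ? & _ & _ & _ & H). now destruct H as (? & ? & _).
  - destruct H as (_ & H). now destruct H as (? & ? & _).
Qed.

(** The value 2 exceeds the weight of every first state, so invocations lower the total; becoming
    idle again takes a completed operation. *)
Definition tweight (s : tstate) : nat :=
  match s with Idle => 2 | Busy s => weight s end.

Definition total (N : nat) (c : config) : nat :=
  list_sum (map (fun t => tweight (cthr c t)) (seq 0 N)).

Lemma list_sum_update (f g : nat -> nat) l t : In t l -> NoDup l -> (forall u, u <> t -> g u = f u) ->
  list_sum (map g l) + f t = list_sum (map f l) + g t.
Proof.
  unfold list_sum. induction l as [|a l IH]; cbn; [tauto|]. intros H Hd Hu.
  inversion_clear Hd.
  destruct (Nat.eq_dec a t) as [-> | Hne].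
  - replace (map g l) with (map f l); [lia|].
    apply map_ext_in. intros b Hb. symmetry. apply Hu. congruence.
  - destruct H as [|H]; [contradiction|]. rewrite (Hu a Hne).
    specialize (IH H H1 Hu). lia.
Qed.

Lemma total_update N c c' t : t < N -> (forall u, u <> t -> cthr c' u = cthr c u) ->
  total N c' + tweight (cthr c t) = total N c + tweight (cthr c' t).
Proof.
  intros Ht Hu. unfold total.
  apply (list_sum_update (fun t => tweight (cthr c t)) (fun t => tweight (cthr c' t))).
  - apply in_seq. lia.
  - apply seq_NoDup.
  - intros u H. now rewrite Hu.
Qed.

Definition quiet_step (N : nat) (G : ghost) (c c' : config) : Prop :=
  quiet G (cmem c) G (cmem c') /\
  exists t s s', t < N /\ cthr c t = Busy s /\ cthr c' t = Busy s' /\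
    exec (cmem c) s = (cmem c', inl s') /\ forall u, u <> t -> cthr c' u = cthr c u.

Lemma sinv_step N G c c' l : sinv G c -> sys_step N c c' l ->
  exists G', sinv G' c' /\
  (l = None -> total N c' < total N c \/
     total N c' = total N c /\
     (measure_decr G (cmem c) G' (cmem c') \/ G' = G /\ quiet_step N G c c')).
Proof.
  intros S (t & Ht & Hstep & Hu). pose proof (total_update N c c' t Ht Hu) as Hw.
  destruct S as [S1 S2 S3].
  inversion Hstep as [m o E1 E2 E3 E4 | m s m' s' He E1 E2 E3 E4 | m s m' r He E1 E2 E3 E4];
    subst m.
  - rewrite <- E2, <- E4 in Hw. exists G. split.
    + constructor.
      * now rewrite <- E3.
      * intros u s. rewrite <- E3. destruct (Nat.eq_dec u t) as [-> | Hne].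
        -- rewrite <- E4. intros [= <-]. destruct o; cbn; auto.
        -- rewrite Hu by auto. apply S2.
      * assert (Ho : own (start o) = None) by now destruct o.
        intros u u' s s' a Hne Hs Hs' Ha Ha'.
        destruct (Nat.eq_dec u t) as [-> | Hut]; [congruence|].
        destruct (Nat.eq_dec u' t) as [-> | Hut']; [congruence|].
        rewrite Hu in Hs, Hs' by auto. now apply (S3 u u' _ _ a Hne Hs Hs' Ha).
    + intros _. left. enough (tweight (Busy (start o)) < tweight Idle) by lia.
      destruct o; cbn; lia.
  - subst m'. symmetry in E2, E4.
    destruct (exec_step G (cmem c) s (cmem c') (inl s') S1 (S2 _ _ E2) He)
      as (G' & K1 & K2 & K3 & K4 & K5).
    exists G'. split.
    + constructor; auto.
      * intros u s0. destruct (Nat.eq_dec u t) as [-> | Hne].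
        -- rewrite E4. intros [= <-]. auto.
        -- rewrite Hu by auto. intros Hs. apply (ext_tinv G (cmem c) G' (cmem c') (own s)); eauto.
      * intros u u' s1 s2 a Hne Hs Hs' Ha Ha'.
        destruct (Nat.eq_dec u t) as [-> | Hut].
        { rewrite Hu in Hs' by auto. replace s1 with s' in * by congruence.
          apply K4 in Ha. apply (own_private G (cmem c)) in Ha'; eauto. lia. }
        destruct (Nat.eq_dec u' t) as [-> | Hut'].
        { rewrite Hu in Hs by auto. replace s2 with s' in * by congruence.
          apply K4 in Ha'. apply (own_private G (cmem c)) in Ha; eauto. lia. }
        rewrite Hu in Hs, Hs' by auto. now apply (S3 u u' _ _ a Hne Hs Hs' Ha).
    + intros _. rewrite E2, E4 in Hw. cbn in Hw.
      destruct K5 as [K5 | [K5 [K6 | K6]]]; [left; lia | right | right]; split; try lia; auto.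
      right. destruct K6 as [-> K6]. split; auto. split; [split; auto|].
      exists t, s, s'. auto.
  - subst m'. symmetry in E2, E4.
    destruct (exec_step G (cmem c) s (cmem c') (inr r) S1 (S2 _ _ E2) He)
      as (G' & K1 & K2 & _).
    exists G'. split; [|congruence].
    constructor; auto.
    + intros u s0. destruct (Nat.eq_dec u t) as [-> | Hne]; [congruence|].
      rewrite Hu by auto. intros Hs. apply (ext_tinv G (cmem c) G' (cmem c') (own s)); eauto.
    + intros u u' s1 s2 a Hne Hs Hs' Ha Ha'.
      destruct (Nat.eq_dec u t) as [-> | Hut]; [congruence|].
      destruct (Nat.eq_dec u' t) as [-> | Hut']; [congruence|].
      rewrite Hu in Hs, Hs' by auto. now apply (S3 u u' _ _ a Hne Hs Hs' Ha).
Qed.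

(** * Termination of a thread while the linked nodes do not change *)

Definition calm (G : ghost) (m0 m : mem) : Prop :=
  ginv G m /\ forall a, In a (pub G) -> heap m a = heap m0 a.

(** The memories are arbitrary calm ones and are not linked between consecutive steps. This absorbs
    all quiet interference, so that each thread can be treated in isolation. *)
Definition qstep (G : ghost) (m0 : mem) (s' s : pc) : Prop :=
  exists m m', calm G m0 m /\ calm G m0 m' /\ tinv G m s /\
    exec m s = (m', inl s').

Inductive back (m : mem) (t : nat) : nat -> nat -> Prop :=
| back_stop s : ts (heap m s) <= t -> back m t s s
| back_step s y : t < ts (heap m s) -> back m t (prior (heap m s)) y -> back m t s y.

(** The walk stops at the latest at the base of the chain, whose stamp is at most [born G x]. *)
Lemma back_chain G m t x s y : chain G m x s -> back m t s y -> born G x <= t ->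
  In y (pub G) /\ klt (key (heap m x)) (key (heap m y)).
Proof.
  intros Hc. revert y. induction Hc as [s Hs Hk Ht Hb | s Hs Hk _ IH]; intros y Hy Hx.
  - inversion Hy; subst; auto. lia.
  - inversion Hy; subst; auto.
Qed.

Section Calm.
Variables (G : ghost) (m0 : mem).
Hypothesis I0 : ginv G m0.

Local Notation halts := (Acc (qstep G m0)).

Lemma halts_intro s :
  (forall m m' s', calm G m0 m -> calm G m0 m' -> tinv G m s ->
     exec m s = (m', inl s') -> halts s') -> halts s.
Proof. intros H. constructor. intros s' (m & m' & H1 & H2 & H3 & H4). eauto. Qed.

Ltac qs := apply halts_intro; intros m m' s' [Im Hm] [Im' Hm'] Ht He;
  cbn in Ht, He; unfold rd in He.

Local Arguments Nat.ltb : simpl never.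

(** Counted over all nodes ever linked because a traversal may also pass through unlinked ones. *)
Definition above (x : nat) : nat :=
  count (fun a => ekey_lt (key (heap m0 x)) (key (heap m0 a))) (pub G).

Definition below (k : ekey) : nat :=
  count (fun a => ekey_lt (key (heap m0 a)) k) (pub G).

Lemma above_lt x y : In y (pub G) -> klt (key (heap m0 x)) (key (heap m0 y)) ->
  above y < above x.
Proof.
  intros Hy Hk. apply count_lt with y; auto.
  - intros a _ H. now apply (klt_trans _ (key (heap m0 y))).
  - apply not_true_is_false. apply klt_irrefl.
Qed.

Lemma below_lt x k : In x (pub G) -> klt (key (heap m0 x)) k ->
  below (key (heap m0 x)) < below k.
Proof.
  intros Hx Hk. apply count_lt with x; auto.
  - intros a _ H. now apply (klt_trans _ (key (heap m0 x))).
  - apply not_true_is_false. apply klt_irrefl.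
Qed.

Lemma above_succ x : In x (pub G) -> succ_of m0 x <> NULL ->
  above (succ_of m0 x) < above x.
Proof. intros H1 H2. apply above_lt; now apply (g_succ _ _ I0). Qed.

Lemma calm_succ m x : (forall a, In a (pub G) -> heap m a = heap m0 a) ->
  In x (pub G) -> pref (next (heap m x)) = succ_of m0 x.
Proof. intros H1 H2. unfold succ_of. now rewrite H1. Qed.

Lemma at_time_chain t x : at_time G m0 t x -> key (heap m0 x) <> KPosInf ->
  chain G m0 x (succ_of m0 x) /\ born G x <= t.
Proof.
  intros [(H1 & H2 & H3) H4] Hk. split.
  - apply (g_chain _ _ I0); auto. now rewrite (g_null _ _ I0).
  - pose proof (g_born _ _ I0 x H2 H3). lia.
Qed.

Lemma calm_at_time m t x : (forall a, In a (pub G) -> heap m a = heap m0 a) ->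
  at_time G m t x -> at_time G m0 t x.
Proof.
  intros Hm [(H1 & H2 & H3) H4]. unfold at_time, visited, set_ts in *.
  rewrite Hm in * by auto. auto.
Qed.

Lemma halts_I_Ts2 n t : halts (I_Ts2 n t).
Proof. qs. destruct (cas_ts _ _ _). discriminate. Qed.

Lemma halts_I_Ts1 n : halts (I_Ts1 n).
Proof. qs. injection He as <- <-. apply halts_I_Ts2. Qed.

(** * Range queries: walks along [prior] and collection *)

Section Range.
Variables (low high : Z) (t : nat).

(** Addresses decrease along [prior]. Restricting the premise to the stopping points of the walk
    lets [back_chain] supply the larger key. *)
Lemma halts_Q_CBack s acc :
  (forall y, back m0 t s y -> halts (Q_Col low high t y acc)) ->
  halts (Q_CBack low high t s acc).
Proof.
  induction s as [s IH] using lt_wf_ind. intros Hb.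
  qs. injection He as <- <-. destruct Ht as (H1 & H2 & H3).
  pose proof (g_prior _ _ Im s H2) as Hp. rewrite (Hm s H2) in *.
  destruct (Nat.ltb_spec t (ts (heap m0 s))) as [Hlt | Hle].
  - destruct Hp as [Hp | (Hp1 & Hp2 & _)]; [lia|]. apply IH; auto.
    intros y Hy. apply Hb. now apply back_step.
  - apply Hb. now apply back_stop.
Qed.

Lemma halts_Q_CTs2 s g acc : halts (Q_CBack low high t s acc) ->
  halts (Q_CTs2 low high t s g acc).
Proof. intros H. qs. destruct (cas_ts _ _ _). now injection He as <- <-. Qed.

Lemma halts_Q_CTs1 s acc : halts (Q_CBack low high t s acc) ->
  halts (Q_CTs1 low high t s acc).
Proof. intros H. qs. injection He as <- <-. now apply halts_Q_CTs2. Qed.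

Lemma halts_Q_CNext x acc :
  (forall y, above y < above x -> halts (Q_Col low high t y acc)) ->
  halts (Q_CNext low high t x acc).
Proof.
  intros IH. qs. injection He as <- <-. destruct Ht as [Ht Hk].
  assert (Hx : In x (pub G)) by apply Ht.
  rewrite (Hm x Hx) in Hk.
  destruct (at_time_chain t x (calm_at_time m t x Hm Ht) Hk) as [Hc Hb].
  rewrite (calm_succ m x Hm Hx).
  apply halts_Q_CTs1, halts_Q_CBack. intros y Hy.
  destruct (back_chain G m0 t x _ y Hc Hy Hb). apply IH. now apply above_lt.
Qed.

Lemma halts_Q_Col x acc : halts (Q_Col low high t x acc).
Proof.
  revert acc. induction x as [x IH] using (induction_ltof1 _ above). unfold ltof in IH.
  intros acc. qs. destruct (ekey_le _ _); [|discriminate].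
  injection He as <- <-. apply halts_Q_CNext. auto.
Qed.

Lemma halts_Q_LBack s :
  (forall y, back m0 t s y -> halts (Q_Low low high t y)) -> halts (Q_LBack low high t s).
Proof.
  induction s as [s IH] using lt_wf_ind. intros Hb.
  qs. injection He as <- <-. destruct Ht as (H1 & H2 & H3).
  pose proof (g_prior _ _ Im s H2) as Hp. rewrite (Hm s H2) in *.
  destruct (Nat.ltb_spec t (ts (heap m0 s))) as [Hlt | Hle].
  - destruct Hp as [Hp | (Hp1 & Hp2 & _)]; [lia|]. apply IH; auto.
    intros y Hy. apply Hb. now apply back_step.
  - apply Hb. now apply back_stop.
Qed.

Lemma halts_Q_LTs2 s g : halts (Q_LBack low high t s) -> halts (Q_LTs2 low high t s g).
Proof. intros H. qs. destruct (cas_ts _ _ _). now injection He as <- <-. Qed.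

Lemma halts_Q_LTs1 s : halts (Q_LBack low high t s) -> halts (Q_LTs1 low high t s).
Proof. intros H. qs. injection He as <- <-. now apply halts_Q_LTs2. Qed.

Lemma halts_Q_LNext x :
  (forall y, above y < above x -> halts (Q_Low low high t y)) ->
  halts (Q_LNext low high t x).
Proof.
  intros IH. qs. injection He as <- <-. destruct Ht as [Ht Hk].
  assert (Hx : In x (pub G)) by apply Ht.
  rewrite (Hm x Hx) in Hk.
  destruct (at_time_chain t x (calm_at_time m t x Hm Ht) Hk) as [Hc Hb].
  rewrite (calm_succ m x Hm Hx).
  apply halts_Q_LTs1, halts_Q_LBack. intros y Hy.
  destruct (back_chain G m0 t x _ y Hc Hy Hb). apply IH. now apply above_lt.
Qed.

Lemma halts_Q_Low x : halts (Q_Low low high t x).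
Proof.
  induction x as [x IH] using (induction_ltof1 _ above). unfold ltof in IH.
  qs. injection He as <- <-.
  destruct (ekey_lt _ _); [now apply halts_Q_LNext | apply halts_Q_Col].
Qed.

Lemma halts_Q_Refresh ck : (forall t', halts (F_Retry ck (KRQ low high t'))) ->
  halts (Q_Refresh low high ck).
Proof. intros H. qs. injection He as <- <-. apply H. Qed.

(** At the head the walk succeeds at once, since the stamp 2 is within every bound and the key is
    least; this ends the descent of search keys. Any other start may lead to a restart with key
    [ck]. *)
Lemma halts_Q_Back ck pred curr :
  pred = HEAD \/ (forall t', halts (F_Retry ck (KRQ low high t'))) ->
  halts (Q_Back low high t ck pred curr).
Proof.
  intros [-> | H].
  - qs. injection He as <- <-. destruct (g_head _ _ Im) as (_ & -> & -> & _).
    destruct Ht as [(H1 & _) _]. destruct (Nat.ltb_spec t 2); [lia|].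
    apply halts_Q_Low.
  - induction pred as [pred IH] using lt_wf_ind.
    qs. injection He as <- <-. destruct Ht as [(H1 & H2 & H3) _].
    pose proof (g_prior _ _ Im pred H2) as Hp.
    destruct (Nat.ltb_spec t (ts (heap m pred))) as [Hlt | Hle].
    + destruct Hp as [Hp | (Hp1 & Hp2 & _)]; [lia|]. now apply IH.
    + destruct (ekey_le _ _); [apply halts_Q_Low | now apply halts_Q_Refresh].
Qed.

End Range.

(** * Searches, trimming, insertions and removals *)

Section Find.
Variables (fk : ekey) (fc : fcont).
(** The induction hypothesis on search keys: only a range query restarts with a different key. *)
Hypothesis smaller : forall low high t, fc = KRQ low high t -> forall p t',
  In p (pub G) -> klt (key (heap m0 p)) fk ->
  halts (F_Retry (key (heap m0 p)) (KRQ low high t')).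

(** Many hypotheses below offer two alternatives: restarting is known to halt, or the local values
    agree with the static memory, so that no restart occurs. The second serves a fresh traversal and
    yields [R]; the first then covers states with stale values. *)
Local Notation R := (halts (F_Retry fk fc)).

Lemma halts_I_Cas k v pred curr n :
  halts (F_Retry (KFin k) (KIns k v)) \/ next (heap m0 pred) = plain curr ->
  halts (I_Cas k v pred curr n).
Proof.
  intros H. qs. destruct Ht as [(H1 & H2 & _) _]. destruct (cas_next _ _ _ _) as [m1 []] eqn:Hc;
    injection He as <- <-; [apply halts_I_Ts1|].
  apply cas_next_false in Hc as [Hc _]. rewrite Hm in Hc by auto. tauto.
Qed.

Lemma halts_I_Alloc k v pred curr :
  halts (F_Retry (KFin k) (KIns k v)) \/ next (heap m0 pred) = plain curr ->
  halts (I_Alloc k v pred curr).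
Proof. intros H. qs. injection He as <- <-. now apply halts_I_Cas. Qed.

(** A successful marking would change a linked node, and failure requires a stale [p]. *)
Lemma halts_R_Mark2 k curr p :
  halts (F_Retry (KFin k) (KRem1 k)) \/ p = next (heap m0 curr) ->
  halts (R_Mark2 k curr p).
Proof.
  intros H. qs. destruct Ht as [(H1 & _) Hp]. destruct (cas_next _ _ _ _) as [m1 []] eqn:Hc;
    injection He as <- <-.
  - exfalso. apply cas_next_true in Hc as [Hn ->].
    specialize (Hm' curr H1). rewrite <- Hm in Hm' by auto. cbn in Hm'.
    rewrite Nat.eqb_refl in Hm'. apply (f_equal next) in Hm'. cbn in Hm'.
    rewrite Hn in Hm'. apply (f_equal pmark) in Hm'. cbn in Hm'.
    apply unfrozen_bits in Hp. destruct Hp; congruence.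
  - apply cas_next_false in Hc as [Hc _]. rewrite Hm in Hc by auto.
    destruct H; auto. congruence.
Qed.

Lemma halts_R_Mark1 k curr :
  halts (F_Retry (KFin k) (KRem1 k)) \/ ~ frozen m0 curr -> halts (R_Mark1 k curr).
Proof.
  intros H. qs. injection He as <- <-. destruct Ht as (H1 & _). rewrite Hm in * by auto.
  destruct (marked_or_flagged _) eqn:Hf.
  - tauto.
  - apply halts_R_Mark2. auto.
Qed.

(** A fresh traversal settles on a frozen node only by the exit for a [NULL] successor, which by
    [g_null] means key [KPosInf]. So a removal that finds its finite key stands on an unfrozen
    node. *)
Definition good_end (pred curr : nat) : Prop :=
  R \/ next (heap m0 pred) = plain curr /\
       (frozen m0 curr -> key (heap m0 curr) = KPosInf).

Lemma halts_F_CurrTs2 pred curr t : good_end pred curr ->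
  halts (F_CurrTs2 fk fc pred curr t).
Proof.
  intros H. qs. destruct (cas_ts _ _ _) as [m1 b]. injection He as <- He.
  destruct Ht as [((Hfc & [Hp Hpk] & Hpt) & Hc & Hk) _].
  unfold find_ret, rd in He. rewrite !Hm' in He by auto. rewrite Hm in Hpk by auto.
  unfold good_end in H.
  destruct fc as [k v | k | c0 | k | low high t1] eqn:Efc; cbn in Hfc; try subst fk.
  - destruct (ekey_eqb _ _); [discriminate|]. injection He as <-.
    apply halts_I_Alloc. tauto.
  - destruct (ekey_eqb _ _) eqn:Hq; [|discriminate]. injection He as <-.
    apply halts_R_Mark1. apply ekey_eqb_eq in Hq. destruct H as [|[_ H]]; auto.
    right. intros Hf. apply H in Hf. congruence.
  - discriminate.
  - destruct (ekey_eqb _ _); discriminate.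
  - injection He as <-. apply halts_Q_Back. destruct Hpk; auto. right.
    intros t'. eapply smaller; eauto.
Qed.

Lemma halts_F_CurrTs1 pred curr : good_end pred curr -> halts (F_CurrTs1 fk fc pred curr).
Proof. intros H. qs. injection He as <- <-. now apply halts_F_CurrTs2. Qed.

(** Here and up to [halts_T_NewTs1], [R] is assumed outright: this code follows a successful
    trimming CAS, which a fresh traversal of a static list never makes. *)
Lemma halts_F_Check pred curr : R -> halts (F_Check fk fc pred curr).
Proof.
  intros H. qs. injection He as <- <-. destruct (_ || _); auto.
  apply halts_F_CurrTs1. now left.
Qed.

Lemma halts_F_AfterTrim pred : R -> halts (F_AfterTrim fk fc pred).
Proof.
  intros H. qs. injection He as <- <-. destruct (marked_or_flagged _); auto.
  now apply halts_F_Check.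
Qed.

Lemma halts_T_NewTs2 pred nc t : R -> halts (T_NewTs2 fk fc pred nc t).
Proof.
  intros H. qs. destruct (cas_ts _ _ _). injection He as <- <-. now apply halts_F_AfterTrim.
Qed.

Lemma halts_T_NewTs1 pred nc : R -> halts (T_NewTs1 fk fc pred nc).
Proof. intros H. qs. injection He as <- <-. now apply halts_T_NewTs2. Qed.

Definition good_trim (pred victim : nat) : Prop :=
  R \/ next (heap m0 pred) = plain victim.

(** Success would redirect a linked node to a private one, and failure means that [pred] does not
    point to [victim]; with current values the state has no successor at all. *)
Lemma halts_T_Cas pred victim nc : good_trim pred victim ->
  halts (T_Cas fk fc pred victim nc).
Proof.
  intros H. qs. destruct Ht as (c & sc & ((_ & [Hp _] & _) & Hv & _) & _ & _ & Hn & _).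
  destruct (cas_next _ _ _ _) as [m1 []] eqn:Hc; injection He as <- <-.
  - exfalso. apply cas_next_true in Hc as [Hx ->].
    specialize (Hm' pred Hp). rewrite <- Hm in Hm' by auto. cbn in Hm'.
    rewrite Nat.eqb_refl in Hm'. apply (f_equal next) in Hm'. cbn in Hm'.
    rewrite Hx in Hm'. injection Hm' as ->. contradiction.
  - apply cas_next_false in Hc as [Hc _]. rewrite Hm in Hc by auto.
    destruct H; auto. contradiction.
Qed.

Lemma halts_T_Alloc pred victim curr sc : good_trim pred victim ->
  halts (T_Alloc fk fc pred victim curr sc).
Proof. intros H. qs. injection He as <- <-. now apply halts_T_Cas. Qed.

Lemma halts_T_SuccTs2 pred victim curr sc t : good_trim pred victim ->
  halts (T_SuccTs2 fk fc pred victim curr sc t).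
Proof.
  intros H. qs. destruct (cas_ts _ _ _). injection He as <- <-. now apply halts_T_Alloc.
Qed.

Lemma halts_T_SuccTs1 pred victim curr sc : good_trim pred victim ->
  halts (T_SuccTs1 fk fc pred victim curr sc).
Proof. intros H. qs. injection He as <- <-. now apply halts_T_SuccTs2. Qed.

Lemma halts_T_Succ pred victim curr : good_trim pred victim ->
  halts (T_Succ fk fc pred victim curr).
Proof.
  intros H. qs. injection He as <- <-.
  destruct (Nat.eqb _ _); [now apply halts_T_Alloc | now apply halts_T_SuccTs1].
Qed.

Lemma halts_T_FlagFail pred victim curr : good_trim pred victim ->
  R \/ pflag (next (heap m0 curr)) = true -> halts (T_FlagFail fk fc pred victim curr).
Proof.
  intros H Hf. qs. injection He as <- <-. destruct Ht as (_ & _ & _ & Hc & _).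
  rewrite Hm by auto. destruct (pflag _) eqn:Hp; [now apply halts_T_Succ|].
  destruct Hf; [auto | congruence].
Qed.

Lemma halts_T_Flag2 pred victim curr p : good_trim pred victim ->
  R \/ p = next (heap m0 curr) -> halts (T_Flag2 fk fc pred victim curr p).
Proof.
  intros H Hf. qs. destruct Ht as ((_ & _ & _ & Hcu & _) & _ & Hp).
  destruct (cas_next _ _ _ _) as [m1 []] eqn:Hc; injection He as <- <-.
  - now apply halts_T_Succ.
  - apply cas_next_false in Hc as [Hc _]. rewrite Hm in Hc by auto.
    apply halts_T_FlagFail; auto. destruct Hf; [auto | congruence].
Qed.

(** The end of the marked path is unmarked; if frozen, it is flagged, and then failing to flag it
    does not cause a restart. *)
Lemma halts_T_Flag1 pred victim curr : good_trim pred victim ->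
  R \/ pmark (next (heap m0 curr)) = false -> halts (T_Flag1 fk fc pred victim curr).
Proof.
  intros H Hf. qs. injection He as <- <-. destruct Ht as ((_ & _ & _ & Hc & _) & _).
  rewrite Hm by auto. destruct (marked_or_flagged _) eqn:Hp.
  - apply halts_T_FlagFail; auto. destruct Hf as [|Hf]; auto.
    unfold marked_or_flagged in Hp. rewrite Hf in Hp. auto.
  - apply halts_T_Flag2; auto.
Qed.

Lemma halts_T_Ts2 pred victim curr t : good_trim pred victim ->
  R \/ pmark (next (heap m0 curr)) = false -> halts (T_Ts2 fk fc pred victim curr t).
Proof.
  intros H Hf. qs. destruct (cas_ts _ _ _). injection He as <- <-. now apply halts_T_Flag1.
Qed.

Lemma halts_T_Ts1 pred victim curr : good_trim pred victim ->
  R \/ pmark (next (heap m0 curr)) = false -> halts (T_Ts1 fk fc pred victim curr).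
Proof. intros H Hf. qs. injection He as <- <-. now apply halts_T_Ts2. Qed.

Lemma halts_T_Step pred victim curr :
  (forall c, above c < above curr -> halts (T_While fk fc pred victim c)) ->
  halts (T_Step fk fc pred victim curr).
Proof.
  intros IH. qs. injection He as <- <-. destruct Ht as ((_ & _ & _ & Hc & _) & Hk).
  rewrite (calm_succ m curr Hm Hc). apply IH. apply above_succ; auto.
  apply (g_mark _ _ I0); auto. now rewrite <- Hm.
Qed.

Lemma halts_T_While pred victim curr : good_trim pred victim ->
  halts (T_While fk fc pred victim curr).
Proof.
  intros H. induction curr as [curr IH] using (induction_ltof1 _ above). unfold ltof in IH.
  qs. injection He as <- <-. destruct Ht as (_ & _ & _ & Hc & _). rewrite Hm by auto.
  destruct (pmark _) eqn:Hp; [now apply halts_T_Step | apply halts_T_Ts1; auto].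
Qed.

Definition good_scan (pred : nat) (pn : ptr) (curr : nat) : Prop :=
  R \/ pn = next (heap m0 pred) /\ (frozen m0 curr -> key (heap m0 curr) = KPosInf).

Lemma halts_F_PredTs2 pred pn curr t : good_scan pred pn curr ->
  halts (F_PredTs2 fk fc pred pn curr t).
Proof.
  intros H. qs. destruct Ht as [(_ & _ & Hu & _) _].
  destruct (cas_ts _ _ _). injection He as <- <-.
  destruct (ptr_eqb _ _) eqn:Hq.
  - apply ptr_eqb_eq in Hq. apply halts_F_CurrTs1.
    destruct H as [H | [H1 H2]]; [now left | right]. split; auto. congruence.
  - apply halts_T_While. destruct H as [H | [H1 H2]]; [now left | right].
    rewrite <- H1. now apply unfrozen_plain.
Qed.

Lemma halts_F_PredTs1 pred pn curr : good_scan pred pn curr ->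
  halts (F_PredTs1 fk fc pred pn curr).
Proof. intros H. qs. injection He as <- <-. now apply halts_F_PredTs2. Qed.

Definition scans (curr : nat) : Prop :=
  forall pred pn, R \/ pn = next (heap m0 pred) -> halts (F_While fk fc pred pn curr).

Lemma halts_F_Adv pred : (forall c, above c < above pred -> scans c) ->
  R \/ ~ frozen m0 pred -> halts (F_Adv fk fc pred).
Proof.
  intros IH H. qs. injection He as <- <-. destruct Ht as (_ & Hp & Hk).
  rewrite Hm in * by auto. destruct (marked_or_flagged _) eqn:Hf.
  - destruct H; auto. contradiction.
  - apply IH; auto. apply above_succ; auto. rewrite (g_null _ _ I0) by auto.
    now apply klt_neq_PosInf in Hk.
Qed.

Lemma halts_F_KeyTest pred pn curr : (forall c, above c < above curr -> scans c) ->
  good_scan pred pn curr -> halts (F_KeyTest fk fc pred pn curr).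
Proof.
  intros IH H. qs. injection He as <- <-. destruct Ht as (_ & _ & _ & _ & Hc & _).
  rewrite Hm by auto. destruct (ekey_le _ _) eqn:Hk.
  - now apply halts_F_PredTs1.
  (* A frozen node would have key [KPosInf] here, and the search never advances past that key. *)
  - apply halts_F_Adv; auto. destruct H as [H | [_ H]]; auto. right.
    intros Hf. apply H in Hf. rewrite Hf, ekey_le_PosInf in Hk. discriminate.
Qed.

Lemma halts_F_Step pred pn curr : (forall c, above c < above curr -> scans c) ->
  R \/ pn = next (heap m0 pred) -> halts (F_Step fk fc pred pn curr).
Proof.
  intros IH H. qs. injection He as <- <-.
  destruct Ht as ((_ & _ & _ & _ & Hc & _) & _ & Hn).
  rewrite (calm_succ m curr Hm Hc). apply IH; auto. apply above_succ; auto.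
  unfold succ_of in *. now rewrite <- Hm.
Qed.

Lemma halts_F_NullTest pred pn curr : (forall c, above c < above curr -> scans c) ->
  R \/ pn = next (heap m0 pred) -> halts (F_NullTest fk fc pred pn curr).
Proof.
  intros IH H. qs. injection He as <- <-.
  destruct Ht as ((_ & _ & _ & _ & Hc & _) & _).
  rewrite (calm_succ m curr Hm Hc).
  destruct (Nat.eqb_spec (succ_of m0 curr) NULL) as [Hn | Hn].
  - apply halts_F_KeyTest; auto. destruct H; [now left | right]. split; auto.
    intros _. now apply (g_null _ _ I0).
  - now apply halts_F_Step.
Qed.

Lemma halts_F_While curr : scans curr.
Proof.
  induction curr as [curr IH] using (induction_ltof1 _ above). unfold ltof in IH.
  intros pred pn H. qs. injection He as <- <-. destruct Ht as (_ & _ & _ & _ & Hc & _).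
  rewrite Hm by auto. destruct (marked_or_flagged _) eqn:Hf.
  - now apply halts_F_NullTest.
  - apply halts_F_KeyTest; auto. destruct H; [now left | right]. split; auto.
    unfold frozen. congruence.
Qed.

Lemma halts_F_Retry : R.
Proof.
  qs. injection He as <- <-. apply halts_F_While. right.
  now rewrite Hm by apply (g_head _ _ Im).
Qed.

End Find.

(** The continuation stays general in the induction because a restarted range query carries a new
    time bound. *)
Lemma halts_retry fk fc : halts (F_Retry fk fc).
Proof.
  revert fc. induction fk as [fk IH] using (induction_ltof1 _ below). unfold ltof in IH.
  intros fc. apply halts_F_Retry. intros low high t _ p t' Hp Hk.
  apply IH. now apply below_lt.
Qed.

(** With all restarts settled, the first alternative always applies and stale local values do no
    harm. *)
Lemma halts_all s : halts s.
Proof.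
  assert (R := halts_retry).
  assert (W : forall fk fc c, scans fk fc c).
  { intros fk fc c. apply halts_F_While. intros. apply R. }
  assert (GE : forall fk fc p c, good_end fk fc p c) by (left; apply R).
  assert (GT : forall fk fc p v, good_trim fk fc p v) by (left; apply R).
  assert (GS : forall fk fc p pn c, good_scan fk fc p pn c) by (left; apply R).
  destruct s;
    auto using halts_F_NullTest, halts_F_Step, halts_F_Adv, halts_F_AfterTrim, halts_F_Check,
      halts_F_KeyTest, halts_F_PredTs1, halts_F_PredTs2, halts_F_CurrTs1, halts_F_CurrTs2,
      halts_T_While, halts_T_Step, halts_T_Ts1, halts_T_Ts2, halts_T_Flag1, halts_T_Flag2,
      halts_T_FlagFail, halts_T_Succ, halts_T_SuccTs1, halts_T_SuccTs2, halts_T_Alloc,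
      halts_T_Cas, halts_T_NewTs1, halts_T_NewTs2, halts_I_Ts1, halts_I_Ts2,
      halts_Q_Low, halts_Q_Col,
      halts_I_Alloc, halts_I_Cas, halts_R_Mark1, halts_R_Mark2, halts_Q_LBack, halts_Q_CBack,
      halts_Q_LTs1, halts_Q_LTs2, halts_Q_CTs1, halts_Q_CTs2, halts_Q_LNext, halts_Q_CNext,
      halts_Q_Refresh, halts_Q_Back.
  - apply W. now left.
  - qs. injection He as <- <-. apply R.
Qed.

End Calm.

(** * Lock-freedom *)

(** The last thread is eliminated by well-founded induction on its state: the suffix after its first
    move starts from a smaller state, and if it never moves, the other threads alone make an
    infinite run. *)
Lemma no_infinite_interleaving (A : Type) (R : A -> A -> Prop) (N : nat) :
  well_founded R -> forall f : nat -> nat -> A,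
  ~ forall i, exists t, t < N /\ R (f (S i) t) (f i t) /\
      forall u, u <> t -> f (S i) u = f i u.
Proof.
  intros WF. induction N as [|N IHN]; intros f H.
  { destruct (H 0) as (t & Ht & _). lia. }
  remember (f 0 N) as x eqn:Ex. revert f H Ex.
  induction x as [x IHx] using (well_founded_induction WF). intros f H ->.
  assert (Hno : forall i, ~ R (f (S i) N) (f i N)).
  { intros i. induction i as [i IHi] using lt_wf_ind. intros Hi.
    assert (Hc : forall j, j <= i -> f j N = f 0 N).
    { induction j as [|j IHj]; auto. intros Hj. rewrite <- IHj by lia.
      destruct (H j) as (t & _ & Ht & Hu).
      destruct (Nat.eq_dec t N) as [-> | Hne]; [exfalso; apply (IHi j); auto | auto]. }
    rewrite (Hc i) in Hi by auto.
    apply (IHx _ Hi (fun k => f (S i + k))); [|now rewrite Nat.add_0_r].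
    intros k. rewrite Nat.add_succ_r. apply H. }
  apply (IHN f). intros i. destruct (H i) as (t & Ht & Hr & Hu).
  exists t. splits; auto. destruct (Nat.eq_dec t N) as [-> | Hne]; [now apply Hno in Hr | lia].
Qed.

(** [total] comes first since the insertions and markings that lower it may raise the other
    components. *)
Definition rank (N : nat) (G : ghost) (c : config) : nat * (nat * (nat * nat)) :=
  (total N c, (marked_live G (cmem c), (unfrozen_pub G (cmem c), unset_pub G (cmem c)))).

Definition rank_lt : nat * (nat * (nat * nat)) -> nat * (nat * (nat * nat)) -> Prop :=
  slexprod _ _ lt (slexprod _ _ lt (slexprod _ _ lt lt)).

Lemma rank_lt_wf : well_founded rank_lt.
Proof. repeat apply wf_slexprod; apply lt_wf. Qed.

Lemma rank_decr N G c G' c' :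
  total N c' < total N c \/
  total N c' = total N c /\ measure_decr G (cmem c) G' (cmem c') ->
  rank_lt (rank N G' c') (rank N G c).
Proof.
  unfold rank, rank_lt, measure_decr.
  intros [H | [-> [H | [-> [H | [-> H]]]]]].
  - now apply left_slex.
  - now apply right_slex, left_slex.
  - now apply right_slex, right_slex, left_slex.
  - now apply right_slex, right_slex, right_slex.
Qed.

Lemma rank_quiet N G c c' : total N c' = total N c ->
  quiet G (cmem c) G (cmem c') -> rank N G c' = rank N G c.
Proof.
  intros H [_ Hq]. unfold rank, marked_live, unfrozen_pub, unset_pub. rewrite H.
  f_equal. f_equal; [|f_equal]; apply count_ext; intros a Ha; now rewrite Hq.
Qed.

Lemma quiet_steps_end N G (e : nat -> config) :
  (forall i, sinv G (e i)) -> (forall i, quiet_step N G (e i) (e (S i))) -> False.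
Proof.
  intros Si Q. set (m0 := cmem (e 0)).
  assert (Hm : forall i, calm G m0 (cmem (e i))).
  { intros i. split; [apply Si|]. induction i as [|i IH]; auto.
    intros a Ha. destruct (Q i) as [[_ Hq] _]. now rewrite Hq, IH. }
  pose (T := fun x y => exists s s', x = Busy s' /\ y = Busy s /\ qstep G m0 s' s).
  assert (WF : well_founded T).
  { intros x. constructor. intros y (s & s' & -> & _ & _).
    induction (halts_all G m0 (s_mem _ _ (Si 0)) s') as [s' _ IH].
    constructor. intros y (s1 & s2 & -> & [= <-] & Hq). auto. }
  apply (no_infinite_interleaving _ T N WF (fun i => cthr (e i))).
  intros i. destruct (Q i) as [_ (t & s & s' & Ht & H1 & H2 & He & Hu)].
  exists t. splits; auto. exists s, s'. splits; auto.
  exists (cmem (e i)), (cmem (e (S i))). splits; auto.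
  now apply (s_thr _ _ (Si i) t).
Qed.

Lemma exec_sinv N e l : is_execution N e l -> forall i, exists G, sinv G (e i).
Proof.
  intros [H0 H] i. induction i as [|i [G IH]].
  - rewrite H0. apply sinv_init.
  - destruct (sinv_step N G _ _ _ IH (H i)) as (G' & S' & _). eauto.
Qed.

(** In a silent suffix the rank never increases, so from a minimal value on every step is quiet and
    the same ghost state stays valid; [quiet_steps_end] excludes this. The induction runs over all
    valid ghost states because each step may choose a new one. *)
Lemma no_silent_suffix N e l n : is_execution N e l -> ~ forall m, n <= m -> l m = None.
Proof.
  intros He Hl.
  assert (H : forall x i G, n <= i -> sinv G (e i) -> rank N G (e i) <> x).
  { intros x. induction x as [x IH] using (well_founded_induction rank_lt_wf).
    intros i G Hi Si <-.
    assert (Hq : forall k, sinv G (e (i + k)) /\ rank N G (e (i + k)) = rank N G (e i)).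
    { intros k. induction k as [|k [Sk Hk]]; [now rewrite Nat.add_0_r|].
      rewrite Nat.add_succ_r.
      destruct (sinv_step N G _ _ _ Sk (proj2 He (i + k))) as (G' & S' & HG).
      destruct HG as [HG | [HG1 [HG2 | [-> HG2]]]]; [apply Hl; lia | | |].
      - exfalso. apply (IH (rank N G' (e (S (i + k))))) with (S (i + k)) G'; auto; [|lia].
        rewrite <- Hk. apply rank_decr. auto.
      - exfalso. apply (IH (rank N G' (e (S (i + k))))) with (S (i + k)) G'; auto; [|lia].
        rewrite <- Hk. apply rank_decr. auto.
      - split; auto. rewrite <- Hk. apply rank_quiet; auto. apply HG2. }
    apply (quiet_steps_end N G (fun k => e (i + k))); [apply Hq|].
    intros k. rewrite Nat.add_succ_r. destruct (Hq k) as [Sk Hk].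
    destruct (sinv_step N G _ _ _ Sk (proj2 He (i + k))) as (G' & S' & HG).
    destruct HG as [HG | [HG1 [HG2 | [-> HG2]]]]; auto; [apply Hl; lia | |];
      exfalso; apply (IH (rank N G' (e (S (i + k))))) with (S (i + k)) G'; auto;
      try lia; rewrite <- Hk; apply rank_decr; auto. }
  destruct (exec_sinv N e l He n) as [G Sn]. now apply (H (rank N G (e n)) n G).
Qed.

Theorem theorem49 : forall N : nat, lock_free N.
Proof.
  intros N e l He n. apply NNPP. intros H. apply (no_silent_suffix N e l n He).
  intros m Hm. apply NNPP. eauto.
Qed.
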